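(* Let $k\geq 3$ and assume that $N$ is sufficiently large in terms of $k$. There exist constants $c_k,c_k'>0$ such that the following holds. Let $$(\log N)^{1/c_k}\leq B\leq N\exp\bigl(-(\log N)^{c_k'}\bigr),$$ and let $A\subseteq[N]$ satisfy $$|A|\geq \frac{N}{(\log N)^{c_k}}.$$ Then, for all but an $O_k((\log N)^{-c_k})$ proportion of tuples $\mathbf b=(b_1,\ldots,b_k)\in((B/2,B]\cap\mathbb Z)^k$, the set $A$ contains a configuration $$x+b_1m,\ x+b_2m,\ \ldots,\ x+b_km\qquad\text{with }x\in\mathbb Z,\ m\in[N/B].$$
   Context: For a real number $X\geq1$, $[X]=\{1,2,\ldots,\lfloor X\rfloor\}$. The constants $c_k,c_k'$ depend only on $k$, and $O_k(\cdot)$ denotes an implied constant depending only on $k$. *)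

(* Defs.v *)
From mathcomp Require Import all_boot all_order all_algebra.
From mathcomp Require Import finmap.
From mathcomp Require Import boolp reals.

Set Implicit Arguments.
Unset Strict Implicit.
Unset Printing Implicit Defensive.

Import Order.TTheory GRing.Theory Num.Theory.
Local Open Scope fset_scope.
Local Open Scope ring_scope.

(* [X] = {1, ..., floor X}, as a finite set of integers. *)
Definition segment (R : realType) (X : R) : {fset int} :=
  [fset Posz n | n in iota 1 (Num.truncn X)].

(* (B/2, B] ∩ Z; the restriction to [B] loses nothing, since B/2 < b <= B
   forces b > 0. *)
Definition dyadic (R : realType) (B : R) : {fset int} :=
  [fset b in segment B | B / 2 < b%:~R].

(* For repeated entries b_i = b_j the corresponding points coincide; as in the
   usual convention, no distinctness is required. *)
Definition contains_pattern (k : nat) (A M : {fset int}) (b : 'I_k -> int) : Prop :=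
  exists x m : int, m \in M /\ forall i : 'I_k, x + b i * m \in A.

Lemma in_segment (R : realType) (X : R) (n : int) :
  (n \in segment X) = (1 <= n) && (n%:~R <= X).
Proof.
have aux j : (0 < j)%N -> (j <= Num.truncn X)%N = (j%:R <= X).
  by case: j => // j _; rewrite truncn_gt_nat.
apply/imfsetP/andP => [[j /= + ->]|[n1 nX]].
  by rewrite mem_iota add1n ltnS => /andP[j1 jX]; rewrite -aux.
case: n n1 nX => // j j1 jX; exists j => //=.
by rewrite mem_iota add1n ltnS aux ?jX ?andbT.
Qed.

Lemma in_dyadic (R : realType) (B : R) (b : int) :
  (b \in dyadic B) = (B / 2 < b%:~R <= B).
Proof.
rewrite !inE /= in_segment andbC; case: ltP => //= Bb.
case: (leP b%:~R B) => bB; rewrite ?andbF // andbT.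
rewrite -gtz0_ge1 -(ltr0z R).
have := lt_le_trans Bb bB; rewrite ltr_pdivrMr // mulr_natr mulr2n ltrDl => B0.
by rewrite (lt_trans _ Bb) // divr_gt0.
Qed.

(* Main.v *)
Require Import Defs.
From mathcomp Require Import all_boot all_order all_algebra.
From mathcomp Require Import finmap.
From mathcomp Require Import boolp reals sequences exp.
From mathcomp Require Import topology normedtype trigo derive.
From mathcomp Require Import zify ring lra.

(** Let alpha be the density of A in a progression identified with Z/N, put
    f = 1_A - alpha, and let F(b) count, with normalisation, the pairs (x, m)
    with x + b_i m in A for all i.  As the average over b of a product over i
    factorises, the variance of F over b is a sum of k-th powers of pair
    correlations, and it is small as soon as the autocorrelations
    E_(x,m) f(x) f(x + (b' - b) m) are small for most (b, b').  Expanding these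
    in characters, a frequency contributes only if j (b' - b) is nearly 0 in
    Z/N for many pairs, and by Vinogradov's lemma such a frequency is close to
    a rational with small denominator q.  So either F is concentrated near
    alpha^k, whence almost every b has a pattern, or f has large mean square on
    progressions of difference q and almost full length, and A has increased
    density on one of them.  The increment is polynomial in the density while
    each step costs a polynomial factor in N, so with density (log N)^(-c) the
    iteration ends before N has lost a factor exp((log N)^(1/2)). *)

Set Implicit Arguments.
Unset Strict Implicit.
Unset Printing Implicit Defensive.

Import Order.TTheory GRing.Theory Num.Theory numFieldNormedType.Exports.
Local Open Scope fset_scope.
Local Open Scope ring_scope.

(** * The circular norm on Z/N *)

Section CyclicNorm.
Variable n : nat.
Local Notation N := n.+2.
Implicit Types s t : 'I_N.

Lemma val_natZ (k : nat) : (k%:R : 'I_N) = (k %% N)%N :> nat.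
Proof. by rewrite Zp_nat. Qed.

Lemma natrZ t : (t : nat)%:R = t :> 'I_N.
Proof. by apply: val_inj; rewrite /= val_natZ modn_small. Qed.

(** This is [N] times the distance from [t / N] to the nearest integer. *)
Definition normZ t : nat := minn t (N - t).

Lemma normZ_natE (k : nat) : (k.*2 <= N)%N -> normZ k%:R = k.
Proof. by move=> kN; rewrite /normZ val_natZ modn_small; lia. Qed.

Lemma normZ_half t : ((normZ t).*2 <= N)%N.
Proof. by have := ltn_ord t; rewrite /normZ; lia. Qed.

Lemma normZ_le_nat (k : nat) : (normZ k%:R <= k)%N.
Proof. by rewrite /normZ val_natZ geq_min leq_mod. Qed.

Lemma normZN t : normZ (- t) = normZ t.
Proof.
rewrite /normZ (_ : nat_of_ord (- t) = ((N - t) %% N)%N) //.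
have := ltn_ord t; case: (posnP t) => [-> _|t0 tN].
  by rewrite subn0 modnn subn0 min0n.
by rewrite modn_small; lia.
Qed.

Lemma normZP t : t = (normZ t)%:R \/ t = - (normZ t)%:R.
Proof.
rewrite /normZ; case: (leqP t (N - t)) => [h|h]; [left|right].
  by rewrite natrZ.
have tN := ltn_ord t; rewrite natrB ?natrZ; last exact: ltnW.
suff -> : N%:R = 0 :> 'I_N by rewrite sub0r opprK.
by apply: val_inj; apply: etrans (val_natZ _) _; rewrite modnn.
Qed.

(** Each residue is plus or minus the image of its norm ([normZP]), and the image of a natural
    number has norm at most that number, so only the signs have to be distinguished. *)
Lemma normZD s t : (normZ (s + t)%R <= normZ s + normZ t)%N.
Proof.
have aux (k l : nat) : (normZ (k%:R - l%:R)%R <= k + l)%N.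
  have [kl|lk] := leqP l k.
    by rewrite -natrB //; apply: leq_trans (normZ_le_nat _) _; lia.
  rewrite -normZN opprB -natrB; last exact: ltnW.
  by apply: leq_trans (normZ_le_nat _) _; lia.
case: (normZP s) => {1}->; case: (normZP t) => {1}->.
- by rewrite -natrD normZ_le_nat.
- exact: aux.
- by rewrite addrC addnC aux.
- by rewrite -opprD normZN -natrD normZ_le_nat.
Qed.

End CyclicNorm.

(** * Characters of Z/N in real form *)

Section CyclicCharacters.
Variables (R : realType) (n : nat).
Local Notation N := n.+2.
Implicit Types (s t a : 'I_N) (f : 'I_N -> R).

(** Real and imaginary parts of the additive character exp(2 pi i t / N). Handling them separately
    keeps all sums in [R]. *)
Definition cosZ t : R := cos (pi *+ 2 * (t : nat)%:R / N%:R).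
Definition sinZ t : R := sin (pi *+ 2 * (t : nat)%:R / N%:R).

Let N_neq0 : N%:R != 0 :> R. Proof. by rewrite pnatr_eq0. Qed.

Lemma angle_mod (k : nat) :
  pi *+ 2 * k%:R / N%:R = pi *+ 2 * (k %% N)%N%:R / N%:R + pi *+ 2 *+ (k %/ N)%N :> R.
Proof.
rewrite {1}(divn_eq k N) natrD natrM mulrDr mulrDl addrC; congr (_ + _).
by rewrite mulrA mulfK // mulr_natr.
Qed.

Lemma cosZ_nat (k : nat) : cosZ k%:R = cos (pi *+ 2 * k%:R / N%:R).
Proof. by rewrite /cosZ val_natZ [in RHS]angle_mod periodicn //; exact: cosD2pi. Qed.

Lemma sinZ_nat (k : nat) : sinZ k%:R = sin (pi *+ 2 * k%:R / N%:R).
Proof. by rewrite /sinZ val_natZ [in RHS]angle_mod periodicn //; exact: sinD2pi. Qed.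

Lemma cosZD s t : cosZ (s + t) = cosZ s * cosZ t - sinZ s * sinZ t.
Proof.
rewrite -[s]natrZ -[t]natrZ -natrD !cosZ_nat !sinZ_nat -cosD.
by rewrite natrD mulrDr mulrDl.
Qed.

Lemma sinZD s t : sinZ (s + t) = sinZ s * cosZ t + cosZ s * sinZ t.
Proof.
rewrite -[s]natrZ -[t]natrZ -natrD !cosZ_nat !sinZ_nat -sinD.
by rewrite natrD mulrDr mulrDl.
Qed.

Lemma cosZ0 : cosZ 0 = 1.
Proof. by rewrite /cosZ mulr0 mul0r cos0. Qed.

Lemma sinZ0 : sinZ 0 = 0.
Proof. by rewrite /sinZ mulr0 mul0r sin0. Qed.

Lemma cosZ2DsinZ2 t : cosZ t ^+ 2 + sinZ t ^+ 2 = 1.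
Proof. exact: cos2Dsin2. Qed.

(** Since [- t] is represented by a natural number, parity of the cosine does not apply directly.
    The addition formulas at t + (- t) = 0 give a linear system of determinant 1 for the two values
    at [- t]. *)
Lemma cosZN t : cosZ (- t) = cosZ t.
Proof.
have := cosZD t (- t); have := sinZD t (- t); have := cosZ2DsinZ2 t.
rewrite subrr cosZ0 sinZ0; set c := cosZ t; set s := sinZ t.
set c' := cosZ _; set s' := sinZ _ => h1 h2 h3.
rewrite -[c']mulr1 -h1 -[RHS]mulr1 h3.
rewrite (_ : c' * _ = c * (c * c' - s * s') + s * (s * c' + c * s')); last by ring.
by rewrite -h2 mulr0 addr0.
Qed.

Lemma sinZN t : sinZ (- t) = - sinZ t.
Proof.
have := cosZD t (- t); have := sinZD t (- t); have := cosZ2DsinZ2 t.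
rewrite subrr cosZ0 sinZ0; set c := cosZ t; set s := sinZ t.
set c' := cosZ _; set s' := sinZ _ => h1 h2 h3.
rewrite -[s']mulr1 -h1 -[s in RHS]mulr1 h3.
rewrite (_ : s' * _ = c * (s * c' + c * s') - s * (c * c' - s * s')); last by ring.
by rewrite -h2 mulr0 sub0r.
Qed.

Lemma cosZB s t : cosZ (s - t) = cosZ s * cosZ t + sinZ s * sinZ t.
Proof. by rewrite cosZD cosZN sinZN mulrN opprK. Qed.

Lemma norm_cosZ_le1 t : `|cosZ t| <= 1. Proof. exact: cos_max. Qed.

Lemma cosZ_eq1 t : cosZ t = 1 -> t = 0.
Proof.
move=> ct1; apply/eqP; rewrite -val_eqE /=; apply: contraT; rewrite -lt0n => t_gt0.
have tN : (t : nat)%:R < N%:R :> R by rewrite ltr_nat ltn_ord.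
have t0 : 0 < (t : nat)%:R :> R by rewrite ltr0n.
have : 0 < sin (pi * (t : nat)%:R / N%:R :> R).
  apply: sin_gt0_pi; rewrite !divr_gt0 ?mulr_gt0 ?pi_gt0 ?ltr0n //=.
  by rewrite ltr_pdivrMr ?ltr0n // ltr_pM2l ?pi_gt0.
suff -> : sin (pi * (t : nat)%:R / N%:R :> R) = 0 by rewrite ltxx.
apply/eqP; rewrite -sqrf_eq0 sin2cos2.
have := ct1; rewrite /cosZ mulrnAl mulrnAl cos_mulr2n => h.
by apply/eqP; lra.
Qed.

Lemma sum_sinZ a : \sum_j sinZ (j * a) = 0.
Proof.
have: \sum_j sinZ (j * a) = - \sum_j sinZ (j * a).
  rewrite {1}(reindex_inj (inv_inj (@opprK _))) /= -sumrN.
  by apply: eq_bigr => j _; rewrite mulNr sinZN.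
move=> h; lra.
Qed.

(** Orthogonality: shifting [j] by 1 multiplies the sum by [cosZ a], because the sine sum vanishes
    by symmetry; and [cosZ a = 1] only at 0. *)
Lemma sum_cosZ a : \sum_j cosZ (j * a) = N%:R *+ (a == 0).
Proof.
have [->|a0] := eqVneq a 0.
  under eq_bigr do rewrite mulr0 cosZ0.
  by rewrite sumr_const card_ord.
rewrite mulr0n; have: \sum_j cosZ (j * a) = cosZ a * \sum_j cosZ (j * a).
  rewrite {1}(reindex_inj (addIr 1)) /=.
  under eq_bigr do rewrite mulrDl mul1r cosZD.
  by rewrite sumrB -!mulr_suml sum_sinZ mul0r subr0 mulrC.
move/eqP; rewrite -subr_eq0 -{1}[\sum_j _]mul1r -mulrBl mulf_eq0.
case/orP => [|/eqP //]; rewrite subr_eq0 => /eqP/esym/cosZ_eq1 a1.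
by rewrite a1 eqxx in a0.
Qed.

(** Squared modulus of the unnormalised Fourier coefficient of [f] at frequency [j]. *)
Definition power f (j : 'I_N) : R :=
  (\sum_x f x * cosZ (j * x)) ^+ 2 + (\sum_x f x * sinZ (j * x)) ^+ 2.

Lemma power_ge0 f j : 0 <= power f j.
Proof. by rewrite addr_ge0 ?sqr_ge0. Qed.

Lemma powerE f j : power f j = \sum_x \sum_y f x * f y * cosZ (j * (x - y)).
Proof.
rewrite /power !expr2 !mulr_suml -big_split; apply: eq_bigr => x _ /=.
rewrite !mulr_sumr -big_split; apply: eq_bigr => y _ /=.
by rewrite mulrBr cosZB; ring.
Qed.

(** Wiener-Khinchin identity. After the product-to-sum formula, orthogonality leaves only the pairs
    with y = x + d and y = x - d, which contribute equally by translation. *)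
Lemma sum_power_cosZ f d :
  \sum_j power f j * cosZ (j * d) = N%:R * \sum_x f x * f (x + d).
Proof.
under eq_bigr do rewrite powerE mulr_suml.
rewrite exchange_big mulr_sumr /=.
transitivity (\sum_x \sum_y f x * f y * (2^-1 * (N%:R *+ (x - y + d == 0) + N%:R *+ (x - y - d == 0)))).
  apply: eq_bigr => x _; under eq_bigr do rewrite mulr_suml.
  rewrite exchange_big; apply: eq_bigr => y _ /=.
  under eq_bigr do rewrite -mulrA; rewrite -mulr_sumr; congr (_ * _).
  rewrite -!sum_cosZ -big_split mulr_sumr; apply: eq_bigr => j _ /=.
  by rewrite (mulrBr j (x - y)) (mulrDr j (x - y)) cosZD cosZB; field.
have half (e : 'I_N) : \sum_x \sum_y f x * f y * (N%:R *+ (x - y + e == 0))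
    = N%:R * \sum_x f x * f (x + e).
  rewrite mulr_sumr; apply: eq_bigr => x _.
  rewrite (bigD1 (x + e)) //= opprD addrA subrr sub0r addNr eqxx big1 ?addr0.
    by rewrite mulrC.
  move=> y yx; rewrite addrAC subr_eq0 eq_sym (negbTE yx) mulr0n mulr0 //.
transitivity (2^-1 * (N%:R * \sum_x f x * f (x + d)) + 2^-1 * (N%:R * \sum_x f x * f (x - d))).
  rewrite -!half !mulr_sumr -big_split; apply: eq_bigr => x _.
  rewrite !mulr_sumr -big_split; apply: eq_bigr => y _ /=; ring.
have -> : \sum_x f x * f (x - d) = \sum_x f x * f (x + d).
  rewrite (reindex_inj (addIr d)) /=; apply: eq_bigr => x _.
  by rewrite addrK mulrC.
by rewrite mulr_sumr; lra.
Qed.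

(** Parseval's identity, the case of shift 0. *)
Lemma sum_power f : \sum_j power f j = N%:R * \sum_x f x ^+ 2.
Proof.
have := sum_power_cosZ f 0.
under eq_bigr do rewrite mulr0 cosZ0 mulr1.
by move=> ->; congr (_ * _); apply: eq_bigr => x _; rewrite addr0 expr2.
Qed.

Lemma cos_pi4_ge : 1 / 2 <= cos (pi / 4 : R).
Proof.
have p0 := pi_gt0 R; have c0 : 0 < cos (pi / 4 : R) by apply: cos_gt0_pihalf; lra.
have : cos (pi / 4 *+ 2 : R) = 0 by rewrite -cos_pihalf; congr cos; field.
rewrite cos_mulr2n => h.
rewrite leNgt; apply/negP => c1; set c := cos _ in h c0 c1; nra.
Qed.

Lemma cos_ge_half (x : R) : 0 <= x <= pi / 4 -> 1 / 2 <= cos x.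
Proof.
move=> /andP[x0 x1]; have p0 := pi_gt0 R; apply: le_trans cos_pi4_ge _.
by rewrite leNgt ltr_cos ?in_itv /=; first rewrite -leNgt; lra.
Qed.

(** A weak Jordan inequality: the mean value theorem up to pi / 4, where the derivative is at least
    1/2; beyond that, monotonicity and pi / 2 < 2. *)
Lemma sin_ge_quarter (x : R) : 0 <= x <= pi / 2 -> x / 4 <= sin x.
Proof.
move=> /andP[x0 x1]; have p0 := pi_gt0 R; have p2 := pihalf_lt2 R.
have small (y : R) : 0 <= y <= pi / 4 -> y / 2 <= sin y.
  rewrite le_eqVlt => /andP[/orP[/eqP <-|y0] y1]; first by rewrite mul0r sin0.
  have [|z] := MVT y0 (fun z _ => is_derive_sin z).
    by apply: continuous_subspaceT => z; exact: continuous_sin.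
  rewrite in_itv /= sin0 !subr0 => /andP[z0 zy] ->.
  have : 1 / 2 <= cos z by apply: cos_ge_half; lra.
  by nra.
have [xs|xl] := leP x (pi / 4); first by have := small x; lra.
have : 1 / 2 <= sin (pi / 4 : R).
  have : sin (pi / 4 : R) = cos (pi / 4).
    by rewrite -[RHS]cosN -cosBpihalf; congr cos; field.
  by move=> ->; exact: cos_pi4_ge.
have : sin (pi / 4 : R) <= sin x.
  by rewrite leNgt ltr_sin ?in_itv /=; first rewrite -leNgt; lra.
by lra.
Qed.

Lemma cosZ_mulrn t (l : nat) :
  cosZ (t *+ l) = cos (pi *+ 2 * (normZ t)%:R / N%:R *+ l).
Proof.
have -> : cosZ (t *+ l) = cosZ ((normZ t)%:R *+ l).
  by case: (normZP t) => {1}->; rewrite ?mulNrn ?cosZN.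
rewrite -mulrnA cosZ_nat; congr cos.
by rewrite natrM mulrA -(mulr_natr (_ / _)); ring.
Qed.

(** Every angle in the sum is at most pi / 4, where the cosine is at least 1/2. *)
Lemma sum_cosZ_ge t (l : nat) : (normZ t * l * 8 <= N)%N ->
  l%:R / 2 <= \sum_(i < l) cosZ (t *+ i).
Proof.
move=> hl.
have -> : l%:R / 2 = \sum_(i < l) 2^-1 :> R by rewrite sumr_const card_ord mulr_natl.
apply: ler_sum => i _; rewrite cosZ_mulrn.
have p0 := pi_gt0 R; have -> : 2^-1 = 1 / 2 :> R by rewrite div1r.
apply: cos_ge_half; rewrite mulrn_wge0 /=; last first.
  by apply: divr_ge0 => //; apply: mulr_ge0 => //; apply: mulrn_wge0; apply: ltW.
rewrite -mulr_natr mulrAC -(mulrA _ _ i%:R) -natrM ler_pdivrMr ?ltr0n //.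
have : ((normZ t * i)%N%:R * 8 <= N%:R :> R).
  rewrite -natrM ler_nat; apply: leq_trans hl.
  by rewrite leq_mul2r leq_mul2l ltnW ?orbT // ltn_ord.
by move=> h; nra.
Qed.

(** The usual bound for a geometric sum: multiplied by 2 sin x, with x half the angle of the norm of
    [t], the sum telescopes, and sin x is at least x / 4. *)
Lemma norm_sum_cosZ_le t (M : nat) :
  `|\sum_(m < M) cosZ (t *+ m.+1)| * (normZ t)%:R <= 2 * N%:R.
Proof.
set v := normZ t; pose x : R := pi * v%:R / N%:R.
have p0 := pi_gt0 R; have p1 := pi_ge2 R.
have N0 : 0 < N%:R :> R by rewrite ltr0n.
have vN : v%:R *+ 2 <= N%:R :> R by rewrite -mulrnA ler_nat muln2 normZ_half.
have v0 : 0 <= v%:R :> R by [].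
have x0 : 0 <= x by rewrite divr_ge0 ?mulr_ge0 // ltW.
have x1 : x <= pi / 2 by rewrite /x ler_pdivrMr //; nra.
have sx : x / 4 <= sin x by apply: sin_ge_quarter; rewrite x0.
have tel : \sum_(m < M) cosZ (t *+ m.+1) * (sin x *+ 2) = sin (x *+ (M.*2.+1)) - sin x.
  elim: M => [|M IH]; first by rewrite big_ord0 double0 mulr1n subrr.
  rewrite big_ord_recr /= IH cosZ_mulrn -/v.
  have -> : pi *+ 2 * v%:R / N%:R *+ M.+1 = x *+ M.+1 *+ 2 by rewrite /x !mulrnAl mulrnAC.
  have -> : x *+ (M.+1).*2.+1 = x *+ M.+1 *+ 2 + x by rewrite mulrSr -mul2n mulnC mulrnA.
  have -> : x *+ M.*2.+1 = x *+ M.+1 *+ 2 - x.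
    by rewrite -mulrnA muln2 doubleS [in RHS]mulrSr addrK.
  by rewrite !sinD sinN cosN; ring.
have : `|\sum_(m < M) cosZ (t *+ m.+1)| * (sin x *+ 2) <= 2.
  have sx0 : 0 <= sin x by lra.
  rewrite -[sin x *+ 2]ger0_norm ?mulrn_wge0 // -normrM mulr_suml tel.
  apply: le_trans (ler_normB _ _) _.
  by have := sin_max (x *+ M.*2.+1); have := sin_max x; lra.
have : x * N%:R = pi * v%:R by rewrite /x divfK.
set S := `|_|; have S0 : 0 <= S by exact: normr_ge0.
move=> hx hS.
have : S * x <= 4 by nra.
have : v%:R *+ 2 <= x * N%:R by rewrite hx; nra.
by move=> h1 h2; nra.
Qed.

End CyclicCharacters.

(** * Pigeonhole and Vinogradov's lemma *)

(** The translates of [S] by c l with 0 <= l <= T lie in an interval of D + c T integers and are too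
    large in total to be disjoint; [u] is the difference of two colliding l. *)
Lemma pigeonhole_translates (D c T : nat) (S : {set 'I_D}) : (0 < c)%N ->
  (D + c * T < #|S| * T.+1)%N ->
  exists s s' : 'I_D, exists u : nat,
    [/\ s \in S, s' \in S, (0 < u <= T)%N & s = s' + c * u :> nat]%N.
Proof.
move=> c0 hS; pose g (p : 'I_D * 'I_T.+1) : 'I_(D + c * T).+1 := inord (p.1 + c * p.2).
have gE p : g p = (p.1 + c * p.2)%N :> nat.
  rewrite inordK // ltnS leq_add //; first exact/ltnW.
  by rewrite leq_mul2l -ltnS ltn_ord orbT.
have /dinjectivePn : ~~ dinjectiveb g (setX S [set: 'I_T.+1]).
  apply/negP => /dinjectiveP ginj.
  have : (g @: setX S [set: 'I_T.+1] \subset [set i : 'I_(D + c * T).+1 | (i < D + c * T)%N]).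
    apply/subsetP => _ /imsetP[p _ ->]; rewrite inE gE -addSn leq_add //.
    by rewrite leq_mul2l -ltnS ltn_ord orbT.
  (* The codomain of [g] has one element too many, as [inord] needs a successor; the image misses
     it. *)
  have -> : [set i : 'I_(D + c * T).+1 | (i < D + c * T)%N] = [set~ ord_max].
    apply/setP => i; rewrite !inE -val_eqE /=.
    by have := ltn_ord i; lia.
  move/subset_leq_card; rewrite cardsC1 card_in_imset // cardsX cardsT !card_ord /=.
  by rewrite leqNgt hS.
case=> -[s l]; rewrite inE /= => /andP[sS _] [[s' l']].
rewrite !inE /= andbT => /andP[ne s'S] /(congr1 val); rewrite /= !gE /= => e.
have ne' : s != s' :> nat.
  apply: contraNneq ne => /val_inj ss'; move: e; rewrite -ss' => /addnI/eqP.
  by rewrite eqn_pmul2l // => /eqP/val_inj ->.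
have lT := ltn_ord l; have l'T := ltn_ord l'.
have [lts|lts] : (s' < s)%N \/ (s < s')%N by lia.
  have ll : (l < l')%N by rewrite -(ltn_pmul2l c0); lia.
  exists s, s', (l' - l)%N; split => //; first by lia.
  have cl : (c * l <= c * l')%N by rewrite leq_mul2l (ltnW ll) orbT.
  by rewrite mulnBr; lia.
have ll : (l' < l)%N by rewrite -(ltn_pmul2l c0); lia.
exists s', s, (l - l')%N; split => //; first by lia.
have cl : (c * l' <= c * l)%N by rewrite leq_mul2l (ltnW ll) orbT.
by rewrite mulnBr; lia.
Qed.

(* Vinogradov's lemma.  Disjointness of the translates of S, first by
   consecutive integers (which yields [q]) and then by multiples of [q * c],
   would contradict the density of S. *)
Lemma dense_near_multiples (n D kappa r : nat) (S : {set 'I_D}) (j : 'I_n.+2) :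
  (0 < kappa)%N -> (0 < r)%N -> (kappa.*2 <= D)%N -> (8 * kappa * r <= n.+2)%N ->
  (D <= kappa * #|S|)%N ->
  {in S &, forall s s' : 'I_D, (normZ (j *+ s - j *+ s')%R <= r)%N} ->
  exists q, [/\ (0 < q)%N, (q <= kappa.*2)%N & (normZ (j *+ q)%R * D <= 4 * kappa * q * r)%N].
Proof.
move=> k0 r0 D2k hN hS Sr.
(* With T = 2 kappa - 1 the translates occupy fewer than 2 D integers, while their sizes add up to 2
   kappa |S| >= 2 D. *)
have overlap c : (0 < c)%N -> (c * kappa.*2 <= D)%N ->
    exists s s' : 'I_D, exists u : nat,
    [/\ s \in S, s' \in S, (0 < u <= kappa.*2)%N & s = s' + c * u :> nat]%N.
  move=> c0 hc.
  have [||s [s' [u [sS s'S hu e]]]] := @pigeonhole_translates D c kappa.*2.-1 S => //.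
    rewrite prednK; last by lia.
    have : (c * kappa.*2.-1 < c * kappa.*2)%N by rewrite ltn_pmul2l //; lia.
    have : (D.*2 <= #|S| * kappa.*2)%N by rewrite -doubleMr leq_double mulnC.
    by lia.
  by exists s, s', u; split => //; lia.
have [|s [s' [q [sS s'S /andP[q0 q2] e]]]] := overlap 1%N isT; first by rewrite mul1n.
have wr : (normZ (j *+ q)%R <= r)%N.
  have := Sr s s' sS s'S; rewrite e mul1n mulrnDr addrC addrA addNr add0r //.
set w := normZ _ in wr *; exists q; split => //; rewrite -/w.
have [->|w0] := posnP w; first by rewrite mul0n.
rewrite leqNgt; apply/negP => wD.
(* The least [c] with [c * w] above [r], so that c w <= 2 r. The multiple c u w found next exceeds
   [r] but is at most N / 2, hence does not wrap around, against the hypothesis on [S]. *)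
pose c := (r %/ w).+1.
have cwr : (r < c * w)%N by rewrite /c mulSn addnC {1}(divn_eq r w) ltn_add2l ltn_mod.
have cw2 : (c * w <= r.*2)%N by rewrite /c mulSn; have := leq_divM r w; lia.
have hqc : (q * c * kappa.*2 <= D)%N.
  rewrite -(leq_pmul2l w0) (leq_trans _ (ltnW wD)) //.
  rewrite (_ : w * _ = c * w * (q * kappa.*2))%N; last by lia.
  by rewrite (leq_trans (leq_mul cw2 (leqnn _))) //; lia.
have [|t [t' [u [tS t'S /andP[u0 u2] e']]]] := overlap (q * c)%N _ hqc.
  by rewrite muln_gt0 q0.
have cuw : (c * u * w <= 4 * kappa * r)%N.
  rewrite (_ : c * u * w = c * w * u)%N; last by lia.
  by rewrite (leq_trans (leq_mul cw2 u2)) //; lia.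
have := Sr t t' tS t'S.
rewrite e' mulrnDr addrC addrA addNr add0r -mulnA mulrnA.
have -> : normZ (j *+ q *+ (c * u)) = (c * u * w)%N.
  have -> : normZ (j *+ q *+ (c * u)) = normZ (w%:R *+ (c * u) : 'I_n.+2).
    by case: (normZP (j *+ q)); rewrite -/w => ->; rewrite ?mulNrn ?normZN.
  by rewrite -mulrnA normZ_natE mulnC //; lia.
rewrite leqNgt; case/negP; apply: leq_trans cwr _.
by rewrite -mulnA (mulnC u) mulnA leq_pmulr.
Qed.

(** * The second moment over tuples *)

Section SecondMoment.
Variable R : realType.

Lemma ler_norm_subX (k : nat) (x y : R) : 0 <= x <= 1 -> 0 <= y <= 1 ->
  `|x ^+ k - y ^+ k| <= k%:R * `|x - y|.
Proof.
move=> /andP[x0 x1] /andP[y0 y1]; elim: k => [|k IH]; first by rewrite subrr normr0 mul0r.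
rewrite (_ : _ - _ = x * (x ^+ k - y ^+ k) + (x - y) * y ^+ k); last by rewrite !exprS; ring.
rewrite (le_trans (ler_normD _ _)) // !normrM -natr1 mulrDl mul1r lerD //.
  by rewrite (le_trans _ IH) // ger0_norm // ler_piMl.
by rewrite ler_piMr // ger0_norm ?exprn_ge0 // exprn_ile1.
Qed.

(** Cauchy-Schwarz without roots, from 2 e |x| <= e^2 + x^2. *)
Lemma sum_norm_le (I : finType) (x : I -> R) (e : R) : 0 < e ->
  \sum_i x i ^+ 2 <= e ^+ 2 * #|I|%:R -> \sum_i `|x i| <= e * #|I|%:R.
Proof.
move=> e0 hx.
have : 2 * e * \sum_i `|x i| <= \sum_i (e ^+ 2 + x i ^+ 2).
  rewrite mulr_sumr; apply: ler_sum => i _.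
  by rewrite -(real_normK (num_real (x i))); have := sqr_ge0 (e - `|x i|); lra.
rewrite big_split sumr_const /= -mulr_natr => h.
by rewrite -(ler_pM2l e0); lra.
Qed.

(** Both sides expand to the same quadruple sum; they are the squared Hilbert-Schmidt norms of the
    two Gram matrices of [g]. *)
Lemma exchange_square (I J : finType) (g : I -> J -> R) :
  \sum_i \sum_i' (\sum_j g i j * g i' j) ^+ 2 =
  \sum_j \sum_j' (\sum_i g i j * g i j') ^+ 2.
Proof.
have sq (K L : finType) (f : K -> L -> R) : \sum_k \sum_k' (\sum_l f k l * f k' l) ^+ 2 =
    \sum_k \sum_k' \sum_l \sum_l' f k l * f k' l * (f k l' * f k' l').
  apply: eq_bigr => k _; apply: eq_bigr => k' _.
  by rewrite expr2 mulr_suml; apply: eq_bigr => l _; rewrite mulr_sumr.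
rewrite !sq.
under eq_bigr do (rewrite exchange_big /=; under eq_bigr do rewrite exchange_big /=).
rewrite exchange_big; apply: eq_bigr => j _ /=.
rewrite exchange_big; apply: eq_bigr => j' _ /=.
by apply: eq_bigr => i _; apply: eq_bigr => i' _; ring.
Qed.

Lemma sum_ffun_prod (k D : nat) (u : 'I_D -> R) :
  \sum_(b : {ffun 'I_k -> 'I_D}) \prod_i u (b i) = (\sum_j u j) ^+ k.
Proof. by rewrite -(bigA_distr_bigA (fun _ : 'I_k => u)) prodr_const card_ord. Qed.

Variables (Omega : finType) (D k : nat) (a : Omega -> 'I_D -> R) (alpha e : R).
Hypotheses (D_gt0 : (0 < D)%N) (a01 : forall w b, 0 <= a w b <= 1).
Hypotheses (alpha01 : 0 <= alpha <= 1) (e_gt0 : 0 < e).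
Let g w b := a w b - alpha.
Hypothesis corr_le :
  \sum_b \sum_b' `|\sum_w g w b * g w b'| <= e ^+ 2 * D%:R ^+ 2 * #|Omega|%:R.

Let W : R := #|Omega|%:R.
Let D0 : 0 < D%:R :> R. Proof. by rewrite ltr0n. Qed.
(** For one uniform entry [b], [p w] is the mean of [a w] and [c w w'] that of [a w * a w']; the
    moments over tuples are sums of k-th powers of these. *)
Let p w := (\sum_b a w b) / D%:R.
Let c w w' := (\sum_b a w b * a w' b) / D%:R.

Let mean01 (u : 'I_D -> R) : (forall b, 0 <= u b <= 1) -> 0 <= (\sum_b u b) / D%:R <= 1.
Proof.
move=> u01; rewrite divr_ge0 ?ler0n ?sumr_ge0 //=; last by move=> b _; case/andP: (u01 b).
rewrite ler_pdivrMr // mul1r -[D in D%:R]card_ord -sumr_const.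
by apply: ler_sum => b _; case/andP: (u01 b).
Qed.

Let g_le1 w b : `|g w b| <= 1.
Proof. by rewrite /g ler_norml; have := a01 w b; have := alpha01; lra. Qed.

Let sum_mean_dev : \sum_w `|p w - alpha| <= e * W.
Proof.
apply: sum_norm_le => //.
have pE w : (p w - alpha) ^+ 2 = (\sum_b \sum_b' g w b * g w b') / D%:R ^+ 2.
  have -> : p w - alpha = (\sum_b g w b) / D%:R.
    by rewrite /g sumrB sumr_const card_ord -[alpha *+ D]mulr_natr mulrBl mulfK // lt0r_neq0.
  by rewrite expr_div_n expr2 mulr_suml; under eq_bigr do rewrite mulr_sumr.
under eq_bigr do rewrite pE; rewrite -mulr_suml ler_pdivrMr ?exprn_gt0 //.
rewrite exchange_big /=; under eq_bigr do rewrite exchange_big /=.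
rewrite mulrAC (le_trans _ corr_le) //.
by apply: ler_sum => b _; apply: ler_sum => b' _; exact: ler_norm.
Qed.

(** [exchange_square] moves the hypothesis from pairs (b, b') to pairs (w, w'); one factor of each
    square is bounded trivially by [W]. *)
Let sum_corr_dev : \sum_w \sum_w' `|\sum_b g w b * g w' b| <= e * D%:R * W ^+ 2.
Proof.
rewrite pair_bigA /=.
suff : \sum_(q : Omega * Omega) `|\sum_b g q.1 b * g q.2 b| <= e * D%:R * #|{: Omega * Omega}|%:R.
  by rewrite card_prod natrM -expr2.
apply: sum_norm_le; first by rewrite mulr_gt0.
rewrite -(pair_bigA _ (fun w w' => (\sum_b g w b * g w' b) ^+ 2)) /= exchange_square.
rewrite card_prod natrM exprMn mulrA -/W.
apply: (@le_trans _ _ (\sum_b \sum_b' `|\sum_w g w b * g w b'| * W)).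
  apply: ler_sum => b _; apply: ler_sum => b' _.
  rewrite -real_normK ?num_real // expr2 ler_wpM2l //.
  rewrite (le_trans (ler_norm_sum _ _ _)) // /W -sumr_const; apply: ler_sum => w _.
  by rewrite normrM mulr_ile1.
under eq_bigr do rewrite -mulr_suml.
by rewrite -mulr_suml ler_wpM2r.
Qed.

Lemma second_moment :
  \sum_(b : {ffun 'I_k -> 'I_D}) (\sum_w \prod_i a w (b i) - alpha ^+ k * W) ^+ 2
  <= 5 * k%:R * e * D%:R ^+ k * W ^+ 2.
Proof.
have W0 : 0 <= W by [].
have Dk0 : 0 < D%:R ^+ k :> R by rewrite exprn_gt0.
have k0 : 0 <= k%:R :> R by [].
have ak01 : 0 <= alpha ^+ k <= 1.
  by case/andP: alpha01 => h0 h1; rewrite exprn_ge0 //= exprn_ile1.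
have p01 w : 0 <= p w <= 1 by apply: mean01 => b; exact: a01.
have c01 w w' : 0 <= c w w' <= 1.
  apply: mean01 => b; case/andP: (a01 w b) => ? ?; case/andP: (a01 w' b) => ? ?.
  by rewrite mulr_ge0 //= mulr_ile1.
have first : \sum_(b : {ffun 'I_k -> 'I_D}) \sum_w \prod_i a w (b i) = D%:R ^+ k * \sum_w p w ^+ k.
  rewrite exchange_big mulr_sumr /=; apply: eq_bigr => w _.
  by rewrite sum_ffun_prod -exprMn /p mulrC divfK // lt0r_neq0.
have second : \sum_(b : {ffun 'I_k -> 'I_D}) (\sum_w \prod_i a w (b i)) ^+ 2 =
    D%:R ^+ k * \sum_w \sum_w' c w w' ^+ k.
  transitivity (\sum_(b : {ffun 'I_k -> 'I_D}) \sum_w \sum_w' \prod_i (a w (b i) * a w' (b i))).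
    apply: eq_bigr => b _; rewrite expr2 mulr_suml; apply: eq_bigr => w _.
    by rewrite mulr_sumr; apply: eq_bigr => w' _; rewrite big_split.
  rewrite exchange_big mulr_sumr /=; apply: eq_bigr => w _.
  rewrite exchange_big mulr_sumr /=; apply: eq_bigr => w' _.
  by rewrite (sum_ffun_prod _ (fun b => a w b * a w' b)) -exprMn /c mulrC divfK // lt0r_neq0.
(* Arranged so that both sums consist of differences of k-th powers, each controlled by
   [ler_norm_subX]. *)
have expand : \sum_(b : {ffun 'I_k -> 'I_D}) (\sum_w \prod_i a w (b i) - alpha ^+ k * W) ^+ 2 =
    D%:R ^+ k * (\sum_w \sum_w' (c w w' ^+ k - (alpha ^+ 2) ^+ k)
       - 2 * alpha ^+ k * W * \sum_w (p w ^+ k - alpha ^+ k)).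
  under eq_bigr do rewrite sqrrB.
  rewrite big_split sumrB /= second sumr_const card_ffun !card_ord.
  rewrite sumrMnl -mulr_suml first.
  have -> : \sum_w \sum_w' (c w w' ^+ k - (alpha ^+ 2) ^+ k) =
      \sum_w \sum_w' c w w' ^+ k - (alpha ^+ k * W) ^+ 2.
    under eq_bigr do rewrite sumrB sumr_const.
    by rewrite sumrB sumr_const -mulrnA -mulr_natr natrM exprMn [in RHS]exprMn.
  rewrite sumrB sumr_const -(mulr_natr (alpha ^+ k) #|Omega|) -/W -(mulr_natr _ (D ^ k)) natrX.
  by ring.
rewrite expand.
(* Of the three units, one comes from the correlation of [w] and [w'] and two from their means; the
   cross term in [h2] adds two more, whence the factor 5. *)
have h1 : \sum_w \sum_w' (c w w' ^+ k - (alpha ^+ 2) ^+ k) <=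
    k%:R * (e * W ^+ 2 + 2 * (e * W ^+ 2)).
  apply: (@le_trans _ _ (\sum_w \sum_w' k%:R * (`|\sum_b g w b * g w' b| / D%:R
       + (`|p w - alpha| + `|p w' - alpha|)))).
    apply: ler_sum => w _; apply: ler_sum => w' _.
    apply: le_trans (ler_norm _) _; apply: le_trans (ler_norm_subX k (c01 w w') _) _.
      by case/andP: alpha01 => h0 h1; rewrite exprn_ge0 //= exprn_ile1.
    rewrite ler_wpM2l //.
    have -> : c w w' - alpha ^+ 2 = (\sum_b g w b * g w' b) / D%:R
        + (alpha * (p w - alpha) + alpha * (p w' - alpha)).
      have -> : \sum_b g w b * g w' b = \sum_b a w b * a w' b - alpha * \sum_b a w b
          - alpha * \sum_b a w' b + alpha ^+ 2 * D%:R.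
        rewrite !mulr_sumr -!sumrB -[D in D%:R]card_ord mulr_natr -sumr_const -big_split /=.
        by apply: eq_bigr => b _; rewrite /g; ring.
      by rewrite /c /p; field; rewrite lt0r_neq0.
    apply: le_trans (ler_normD _ _) _; rewrite normrM normfV (ger0_norm (ltW D0)) lerD //.
    apply: le_trans (ler_normD _ _) _; case/andP: alpha01 => al0 al1.
    by rewrite !normrM ger0_norm // lerD // ler_piMl.
  under eq_bigr do rewrite -mulr_sumr.
  rewrite -mulr_sumr ler_wpM2l //.
  under eq_bigr do rewrite big_split -mulr_suml big_split sumr_const /=.
  rewrite big_split -mulr_suml big_split sumr_const /= sumrMnl; apply: lerD.
    by rewrite ler_pdivrMr // mulrAC sum_corr_dev.
  set S := \sum_w _; rewrite -(mulr_natr S) -/W.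
  by have := ler_wpM2r W0 sum_mean_dev; rewrite -/S; lra.
have h2 : - (2 * alpha ^+ k * W * \sum_w (p w ^+ k - alpha ^+ k)) <= 2 * k%:R * e * W ^+ 2.
  apply: le_trans (ler_norm _) _; rewrite normrN.
  have : `|\sum_w (p w ^+ k - alpha ^+ k)| <= k%:R * (e * W).
    apply: le_trans (ler_norm_sum _ _ _) _.
    apply: le_trans (ler_wpM2l k0 sum_mean_dev).
    by rewrite mulr_sumr; apply: ler_sum => w _; exact: ler_norm_subX.
  case/andP: ak01 => ak0 ak1.
  rewrite normrM => h; have -> : `|2 * alpha ^+ k * W| = 2 * alpha ^+ k * W.
    by rewrite ger0_norm // !mulr_ge0.
  apply: (@le_trans _ _ (2 * W * (k%:R * (e * W)))); last by rewrite le_eqVlt; apply/orP; left; apply/eqP; ring.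
  apply: ler_pM => //; first by rewrite !mulr_ge0.
  by rewrite mulrAC ler_piMr // mulr_ge0.
rewrite [leRHS](_ : _ = D%:R ^+ k * (5 * k%:R * e * W ^+ 2)); last by ring.
by rewrite ler_wpM2l ?(ltW Dk0) //; lra.
Qed.

End SecondMoment.

(** * Correlations through the power spectrum *)

Section FourierCorrelation.
Variables (R : realType) (n : nat).
Local Notation N := n.+2.
Implicit Types (j : 'I_N) (g : 'I_N -> R).

(** Squared modulus of the sum of exp(2 pi i t u / N) over u < l, an unnormalised Fejer kernel. It
    serves to majorise the set of frequencies [j] with [j *+ q] near 0. *)
Definition char_power (l : nat) (t : 'I_N) : R :=
  (\sum_(i < l) cosZ R (t *+ i)) ^+ 2 + (\sum_(i < l) sinZ R (t *+ i)) ^+ 2.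

Lemma char_power_ge0 l t : 0 <= char_power l t.
Proof. by rewrite addr_ge0 ?sqr_ge0. Qed.

Lemma char_powerE l t :
  char_power l t = \sum_(i < l) \sum_(i' < l) cosZ R (t *+ i - t *+ i').
Proof.
rewrite /char_power !expr2 !mulr_suml -big_split; apply: eq_bigr => i _ /=.
rewrite !mulr_sumr -big_split; apply: eq_bigr => i' _ /=.
by rewrite cosZB.
Qed.

Lemma char_power_ge l t : (normZ t * l * 8 <= N)%N -> l%:R ^+ 2 <= 4 * char_power l t.
Proof.
move=> /(sum_cosZ_ge R) hl; rewrite /char_power.
have l0 : 0 <= l%:R :> R by [].
set s := \sum_(i < l) sinZ _ _; set c := \sum_(i < l) _ in hl *.
have := sqr_ge0 s; nra.
Qed.

(** Wiener-Khinchin for each pair of terms of the kernel: spectral mass where [j *+ q] is near 0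
    becomes mean square of [g] on progressions of difference [q]. *)
Lemma sum_power_char_power g l (q : nat) :
  \sum_j power g j * char_power l (j *+ q) =
  N%:R * \sum_x (\sum_(i < l) g (x + (q * i)%:R)) ^+ 2.
Proof.
under eq_bigr do rewrite char_powerE mulr_sumr.
rewrite exchange_big mulr_sumr /=.
under [RHS]eq_bigr do rewrite expr2 mulr_suml mulr_sumr.
rewrite [RHS]exchange_big; apply: eq_bigr => i _ /=.
under eq_bigr do rewrite mulr_sumr.
under [RHS]eq_bigr do rewrite !mulr_sumr.
rewrite exchange_big [RHS]exchange_big; apply: eq_bigr => i' _ /=.
rewrite -mulr_sumr [in RHS](reindex_inj (addIr (- (q * i)%:R))) /=.
under [in RHS]eq_bigr do rewrite addrNK.
rewrite (eq_bigr (fun j => power g j * cosZ R (j * ((q * i')%:R - (q * i)%:R)))) => [|j _].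
  rewrite sum_power_cosZ; congr (_ * _); apply: eq_bigr => x _.
  by rewrite addrAC addrA.
congr (_ * _); rewrite -cosZN opprB mulrBr !mulr_natr -!mulrnA //.
Qed.

(** Either some [b] has at least D / kappa many [b'] with [j *+ b'] near [j *+ b]; then Vinogradov's
    lemma gives a [q] whose kernel makes the last term at least 1, and the trivial bound suffices.
    Or in each row the near [b'] cost at most D M / kappa, as do the others by the geometric sum
    bound. *)
Lemma kernel_sum_le j (D M kappa r l : nat) :
  (0 < kappa)%N -> (0 < r)%N -> (kappa.*2 <= D)%N -> (16 * kappa * r <= N)%N ->
  (2 * N * kappa <= r * M)%N -> (128 * kappa ^ 2 * r * l <= N * D)%N -> (0 < l)%N ->
  \sum_(b < D) \sum_(b' < D) `|\sum_(m < M) cosZ R ((j *+ b' - j *+ b) *+ m.+1)|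
  <= D%:R ^+ 2 * M%:R * (2 / kappa%:R
       + 4 / l%:R ^+ 2 * \sum_(q < kappa.*2) char_power l (j *+ q.+1)).
Proof.
move=> k0 r0 kD kr rM hl l0.
have D0 : (0 < D)%N by lia.
have Dr : 0 < D%:R :> R by rewrite ltr0n.
have lr : 0 < l%:R :> R by rewrite ltr0n.
have kr0 : 0 < kappa%:R :> R by rewrite ltr0n.
have sum_le (u : 'I_M -> R) : (forall m, `|u m| <= 1) -> `|\sum_m u m| <= M%:R.
  move=> u1; rewrite (le_trans (ler_norm_sum _ _ _)) // -[M in M%:R]card_ord -sumr_const.
  exact: ler_sum.
pose S (b : 'I_D) := [set b' : 'I_D | (normZ (j *+ b' - j *+ b)%R <= r)%N].
have cp0 : 0 <= 4 / l%:R ^+ 2 * \sum_(q < kappa.*2) char_power l (j *+ q.+1).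
  by rewrite mulr_ge0 ?divr_ge0 ?exprn_ge0 ?sumr_ge0 // => q _; exact: char_power_ge0.
have [/existsP[b Sb]|/existsPn Sb] := boolP [exists b, D <= kappa * #|S b|]%N.
  (* The radius doubles because two members of [S b] are compared through [j *+ b]. *)
  have [//||//||//||q [q0 q2 hq]] := @dense_near_multiples n D kappa r.*2 (S b) j.

  - by rewrite double_gt0.
  - by rewrite -mul2n; lia.
  - move=> s s'; rewrite !inE => hs hs'; rewrite -(subrKA (j *+ b)).
    by rewrite (leq_trans (normZD _ _)) // -addnn leq_add // -normZN opprB.
  have one_le : 1 <= 4 / l%:R ^+ 2 * \sum_(q < kappa.*2) char_power l (j *+ q.+1).
    have q2' : (q.-1 < kappa.*2)%N by lia.
    rewrite (bigD1 (Ordinal q2')) //= prednK // mulrDr.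
    apply: (@le_trans _ _ (4 / l%:R ^+ 2 * char_power l (j *+ q))); last first.
      by rewrite lerDl mulr_ge0 ?divr_ge0 ?exprn_ge0 ?sumr_ge0 // => i _; exact: char_power_ge0.
    rewrite mulrAC ler_pdivlMr ?exprn_gt0 // mul1r char_power_ge //.
    rewrite -(leq_pmul2r D0); apply: leq_trans hl.
    rewrite (_ : (_ * l * 8 * D = normZ (j *+ q) * D * (l * 8)))%N; last by lia.
    apply: leq_trans (leq_mul hq (leqnn _)) _.
    rewrite (_ : 4 * kappa * q * r.*2 * (l * 8) = 64 * kappa * r * l * q)%N; last by lia.
    apply: leq_trans (leq_mul (leqnn _) q2) _; rewrite -mul2n; lia.
  apply: (@le_trans _ _ (D%:R ^+ 2 * M%:R * 1)); last first.
    by rewrite ler_wpM2l ?mulr_ge0 ?exprn_ge0 // (le_trans one_le) // lerDr divr_ge0.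
  rewrite mulr1; apply: (@le_trans _ _ (\sum_(b < D) \sum_(b' < D) M%:R)).
    by apply: ler_sum => ? _; apply: ler_sum => ? _; apply: sum_le => m; exact: norm_cosZ_le1.
  by under eq_bigr do rewrite sumr_const card_ord; rewrite sumr_const card_ord -mulrnA -(mulr_natl M%:R (D * D)) natrM expr2.
apply: (@le_trans _ _ (D%:R ^+ 2 * M%:R * (2 / kappa%:R))); last first.
  by rewrite ler_wpM2l ?mulr_ge0 ?exprn_ge0 // lerDl.
have row (b : 'I_D) : \sum_(b' < D) `|\sum_(m < M) cosZ R ((j *+ b' - j *+ b) *+ m.+1)|
    <= D%:R * M%:R * (2 / kappa%:R).
  have hS : #|S b|%:R <= D%:R / kappa%:R :> R.
    rewrite ler_pdivlMr // -natrM ler_nat mulnC ltnW // ltnNge; exact: Sb.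
  rewrite (bigID [in S b]) /=.
  have h1 : \sum_(b' in S b) `|\sum_(m < M) cosZ R ((j *+ b' - j *+ b) *+ m.+1)|
      <= #|S b|%:R * M%:R.
    rewrite mulr_natl -sumr_const; apply: ler_sum => b' _.
    by apply: sum_le => m; exact: norm_cosZ_le1.
  have h2 : \sum_(b' | b' \notin S b) `|\sum_(m < M) cosZ R ((j *+ b' - j *+ b) *+ m.+1)|
      <= D%:R * (M%:R / kappa%:R).
    apply: (@le_trans _ _ (\sum_(b' | b' \notin S b) M%:R / kappa%:R)).
      apply: ler_sum => b'; rewrite inE -ltnNge => rb.
      have := norm_sum_cosZ_le R (j *+ b' - j *+ b) M.
      set X := `|_|; set v := normZ _ in rb * => hX.
      have X0 : 0 <= X by exact: normr_ge0.
      have rv : r%:R <= v%:R :> R by rewrite ler_nat ltnW.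
      have r0' : 0 < r%:R :> R by rewrite ltr0n.
      have hM : 2 * N%:R * kappa%:R <= r%:R * M%:R :> R by rewrite -!natrM ler_nat.
      rewrite ler_pdivlMr // -(ler_pM2l r0') (le_trans _ hM) // mulrA ler_pM2r //.
      by rewrite (le_trans _ hX) // mulrC ler_wpM2l.
    rewrite sumr_const -(mulr_natl (M%:R / kappa%:R)) ler_wpM2r ?divr_ge0 // ler_nat.
    by rewrite (leq_trans (max_card _)) // card_ord.
  apply: le_trans (lerD h1 h2) _.
  have h3 := ler_wpM2r (ler0n R M) hS.
  rewrite [leRHS](_ : _ = D%:R / kappa%:R * M%:R + D%:R * (M%:R / kappa%:R)); last by ring.
  by rewrite lerD2r.
apply: (@le_trans _ _ (\sum_(b < D) D%:R * M%:R * (2 / kappa%:R))).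
  by apply: ler_sum => b _; exact: row.
by rewrite sumr_const card_ord -(mulr_natl (_ * (2 / kappa%:R))) !mulrA expr2.
Qed.

(** Translating [x] leaves an autocorrelation at shift (b' - b) (m + 1), so the spectrum of [g] is
    summed against the kernel. Parseval gives the term 2 / kappa; the 2 kappa differences [q] give 8
    kappa s. *)
Lemma correlation_le g (D M kappa r l b0 : nat) (s : R) :
  (0 < kappa)%N -> (0 < r)%N -> (kappa.*2 <= D)%N -> (16 * kappa * r <= N)%N ->
  (2 * N * kappa <= r * M)%N -> (128 * kappa ^ 2 * r * l <= N * D)%N -> (0 < l)%N ->
  (forall x, `|g x| <= 1) ->
  (forall q, (0 < q <= kappa.*2)%N ->
     \sum_x (\sum_(i < l) g (x + (q * i)%:R)) ^+ 2 <= s * l%:R ^+ 2 * N%:R) ->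
  \sum_(b < D) \sum_(b' < D) `|\sum_x \sum_(m < M)
      g (x + ((b0 + b) * m.+1)%:R) * g (x + ((b0 + b') * m.+1)%:R)|
  <= D%:R ^+ 2 * M%:R * N%:R * (2 / kappa%:R + 8 * kappa%:R * s).
Proof.
move=> k0 r0 kD kr rM hl l0 g1 hs.
have N0 : 0 < N%:R :> R by rewrite ltr0n.
have lr : 0 < l%:R :> R by rewrite ltr0n.
have corrE (b b' : 'I_D) : N%:R * (\sum_x \sum_(m < M) g (x + ((b0 + b) * m.+1)%:R) * g (x + ((b0 + b') * m.+1)%:R))
    = \sum_j power g j * \sum_(m < M) cosZ R ((j *+ b' - j *+ b) *+ m.+1).
  under [RHS]eq_bigr do rewrite mulr_sumr.
  rewrite exchange_big [RHS]exchange_big mulr_sumr; apply: eq_bigr => m _ /=.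
  rewrite (reindex_inj (addIr (- ((b0 + b) * m.+1)%:R))) /=.
  under eq_bigr do rewrite addrNK -addrA (addrC (- _)).
  rewrite -sum_power_cosZ; apply: eq_bigr => j _; congr (_ * cosZ R _).
  by rewrite mulrBr !mulr_natr mulrnBl -!mulrnA !mulnDl !mulrnDr opprD addrACA subrr add0r.
rewrite -(ler_pM2l N0) mulr_sumr.
under eq_bigr do rewrite mulr_sumr.
apply: (@le_trans _ _ (\sum_j power g j * (\sum_(b < D) \sum_(b' < D)
    `|\sum_(m < M) cosZ R ((j *+ b' - j *+ b) *+ m.+1)|))).
  under [leRHS]eq_bigr do rewrite mulr_sumr.
  rewrite [leRHS]exchange_big; apply: ler_sum => b _ /=.
  under [leRHS]eq_bigr do rewrite mulr_sumr.
  rewrite [leRHS]exchange_big; apply: ler_sum => b' _ /=.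
  rewrite -[N%:R](ger0_norm (ltW N0)) -normrM corrE (le_trans (ler_norm_sum _ _ _)) //.
  by apply: ler_sum => j _; rewrite normrM (ger0_norm (power_ge0 _ _)).
apply: (@le_trans _ _ (\sum_j power g j * (D%:R ^+ 2 * M%:R * (2 / kappa%:R
       + 4 / l%:R ^+ 2 * \sum_(q < kappa.*2) char_power l (j *+ q.+1))))).
  by apply: ler_sum => j _; rewrite ler_wpM2l ?power_ge0 //; exact: (@kernel_sum_le j D M kappa r l).
have -> : \sum_j power g j * (D%:R ^+ 2 * M%:R * (2 / kappa%:R
       + 4 / l%:R ^+ 2 * \sum_(q < kappa.*2) char_power l (j *+ q.+1))) =
   D%:R ^+ 2 * M%:R * (2 / kappa%:R * (\sum_j power g j) + 4 / l%:R ^+ 2 *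
     \sum_(q < kappa.*2) \sum_j power g j * char_power l (j *+ q.+1)).
  rewrite exchange_big /= !mulr_sumr -big_split mulr_sumr; apply: eq_bigr => j _ /=.
  by rewrite -mulr_sumr; ring.
rewrite [leRHS](_ : _ = D%:R ^+ 2 * M%:R * (N%:R * N%:R * (2 / kappa%:R + 8 * kappa%:R * s))); last by ring.
rewrite ler_wpM2l ?mulr_ge0 ?exprn_ge0 // mulrDr lerD //.
  rewrite mulrC ler_wpM2r ?divr_ge0 // sum_power ler_pM2l //.
  rewrite -[N in leRHS]card_ord -sumr_const; apply: ler_sum => x _.
  by rewrite -(real_normK (num_real (g x))) exprn_ile1.
rewrite mulrAC ler_pdivrMr ?exprn_gt0 //.
have : \sum_(q < kappa.*2) \sum_j power g j * char_power l (j *+ q.+1) <=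
    \sum_(q < kappa.*2) N%:R * (s * l%:R ^+ 2 * N%:R).
  apply: ler_sum => q _; rewrite sum_power_char_power ler_pM2l // hs //=.
rewrite sumr_const card_ord -(mulr_natl (N%:R * _)) -mul2n natrM => h.
rewrite (le_trans (ler_wpM2l _ h)) // le_eqVlt; apply/orP; left; apply/eqP; ring.
Qed.

End FourierCorrelation.

(** * Density increments on progressions *)

(** The points counted are those from which a progression of diameter [c] may wrap around modulo
    [N]. *)
Lemma card_top (N c : nat) : (#|[pred x : 'I_N | N <= x + c]| <= c)%N.
Proof.
have [cN|Nc] := leqP c N; last by rewrite (leq_trans (max_card _)) // card_ord ltnW.
rewrite -(card_image (@rev_ord_inj N)) -sum1_card.
apply: (@leq_trans (\sum_(y < N | y < c) 1)%N).
  rewrite big_mkcond [leqRHS]big_mkcond; apply: leq_sum => y _.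
  case: ifP => // /imageP[x]; rewrite inE => hx ->.
  by have := ltn_ord x; rewrite /= => xN; rewrite ifT //; lia.
by rewrite (big_ord_narrow cN) sum1_card card_ord.
Qed.

Lemma val_shift (n c : nat) (x : 'I_n.+2) :
  x + c%:R = ((x + c) %% n.+2)%N :> nat.
Proof. by rewrite -{1}[x]natrZ -natrD val_natZ. Qed.

Section Increment.
Variables (R : realType) (n : nat).
Local Notation N := n.+2.

(** As the sums have mean zero, a large mean square forces a large positive value. Passing to
    positive parts costs a factor 2, and discarding the starting points near [N] costs half of the
    rest, whence s / 4. *)
Lemma exists_increment (g : 'I_N -> R) (l q : nat) (s : R) :
  (forall x, `|g x| <= 1) -> \sum_x g x = 0 -> (0 < l)%N ->
  (q * l)%:R <= s / 4 * N%:R ->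
  s * l%:R ^+ 2 * N%:R < \sum_x (\sum_(i < l) g (x + (q * i)%:R)) ^+ 2 ->
  exists2 x : 'I_N, (x + q * l <= N)%N & s / 4 * l%:R <= \sum_(i < l) g (x + (q * i)%:R).
Proof.
move=> g1 g0 l0 qs; set a := fun x => \sum_(i < l) g (x + (q * i)%:R) => big.
apply: contrapT => none; move: big; rewrite ltNge => /negP; apply.
have lr : 0 < l%:R :> R by rewrite ltr0n.
have N0 : 0 < N%:R :> R by rewrite ltr0n.
have s0 : 0 <= s.
  have h : 0 <= (q * l)%:R :> R by [].
  have := le_trans h qs; rewrite pmulr_lge0 // pmulr_lge0 ?invr_gt0 //.
have a_le x : `|a x| <= l%:R.
  rewrite /a (le_trans (ler_norm_sum _ _ _)) // -[l in l%:R]card_ord -sumr_const.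
  exact: ler_sum.
have a_sum : \sum_x a x = 0.
  rewrite /a exchange_big big1 //= => i _.
  by rewrite -[RHS]g0 [RHS](reindex_inj (addIr (q * i)%:R)).
have small (x : 'I_N) : (x + q * l <= N)%N -> a x < s / 4 * l%:R.
  by move=> hx; rewrite ltNge; apply/negP => ax; apply: none; exists x.
pose top := [pred x : 'I_N | N <= x + q * l]%N.
(* [a^2 <= l |a| = l (2 a^+ - a)], and [a] sums to 0. *)
have step x : a x ^+ 2 <= l%:R * (2 * (s / 4 * l%:R + l%:R *+ top x) - a x).
  have -> : a x ^+ 2 = `|a x| ^+ 2 by rewrite real_normK ?num_real.
  rewrite expr2; apply: ler_pM => //; rewrite /top /=.
  have := a_le x; have sl : 0 <= s / 4 * l%:R by rewrite mulr_ge0 ?divr_ge0.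
  case: leqP => /= [/leqW/small hx|_]; rewrite ?mulr0n ?mulr1n.
    by case: (ger0P (a x)); lra.
  by case: (ger0P (a x)); lra.
apply: le_trans (ler_sum (index_enum _) (fun x _ => step x)) _.
rewrite -mulr_sumr sumrB a_sum subr0 -mulr_sumr big_split sumr_const card_ord /=.
have -> : \sum_(x : 'I_N) l%:R *+ top x = l%:R * #|top|%:R :> R.
  by rewrite -sum1_card natr_sum mulr_sumr [RHS]big_mkcond; apply: eq_bigr => x _; rewrite -[x \in top]/(top x); case: (top x); rewrite ?mulr1.
have : #|top|%:R <= s / 4 * N%:R by apply: le_trans qs; rewrite ler_nat card_top.
move=> h; rewrite -(mulr_natr (s / 4 * l%:R) N).
have h' : l%:R * (2 * (s / 4 * l%:R * N%:R + l%:R * #|top|%:R)) <=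
   l%:R * (2 * (s / 4 * l%:R * N%:R + l%:R * (s / 4 * N%:R))).
  by rewrite ler_pM2l // ler_pM2l // lerD2l ler_pM2l.
by apply: le_trans h' _; rewrite le_eqVlt; apply/orP; left; apply/eqP; field.
Qed.
End Increment.

(** * Patterns among natural numbers *)

Definition count_below (A : pred nat) (N : nat) : nat := #|[pred x : 'I_N | A x]|.

(* [3 * D * m <= N] is an integral substitute for [m <= N / B], where (B/2, B]
   contains D integers and hence [B <= 3 * D]. *)
Definition has_pattern (A : pred nat) (N b0 D k : nat) (b : {ffun 'I_k -> 'I_D}) : Prop :=
  exists x m : nat, [/\ (0 < m)%N, (3 * D * m <= N)%N &
    forall i, (x + (b0 + b i) * m < N)%N /\ A (x + (b0 + b i) * m)%N].

Definition bad_count (A : pred nat) (N b0 D k : nat) : nat :=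
  #|[pred b : {ffun 'I_k -> 'I_D} | ~~ `[< has_pattern A N b0 b >]]|.

(** The map i -> x0 + q i turns step [m] into step [q * m] and leaves [b] unchanged, so the
    iteration can pass to progressions while keeping the same tuples. *)
Lemma has_pattern_sub (A : pred nat) (N b0 D k x0 q l : nat) (b : {ffun 'I_k -> 'I_D}) :
  (0 < q)%N -> (x0 + q * l <= N)%N ->
  has_pattern (fun i => A (x0 + q * i)%N) l b0 b -> has_pattern A N b0 b.
Proof.
move=> q0 hl [x [m [m0 hm hb]]]; exists (x0 + q * x)%N, (q * m)%N.
have qm : (3 * D * (q * m) <= q * l)%N.
  by rewrite (_ : 3 * D * (q * m) = q * (3 * D * m))%N ?leq_mul2l ?hm ?orbT //; lia.
split; [by rewrite muln_gt0 q0 | by lia | move=> i].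
have [h1 h2] := hb i.
rewrite (_ : x0 + q * x + _ = x0 + q * (x + (b0 + b i) * m))%N; last by lia.
split => //; apply: leq_trans hl; rewrite ltn_add2l ltn_pmul2l //.
Qed.

Lemma bad_count_sub (A : pred nat) (N b0 D k x0 q l : nat) :
  (0 < q)%N -> (x0 + q * l <= N)%N ->
  (bad_count A N b0 D k <= bad_count (fun i => A (x0 + q * i)%N) l b0 D k)%N.
Proof.
move=> q0 hl; apply/subset_leq_card/subsetP => b; rewrite !inE.
by apply: contra => /asboolP h; apply/asboolP; exact: has_pattern_sub h.
Qed.

(** * Few bad tuples or a density increment *)

Section Dichotomy.
Variables (R : realType) (n : nat) (A : pred nat).
Local Notation N := n.+2.
Let alpha : R := (count_below A N)%:R / N%:R.
Let f (x : 'I_N) : R := (A x)%:R.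

Let N0 : 0 < N%:R :> R. Proof. by rewrite ltr0n. Qed.

Let f01 x : 0 <= f x <= 1.
Proof. by rewrite /f; case: (A x); rewrite /= ?lexx ?ler01. Qed.

Let sum_f : \sum_x f x = alpha * N%:R.
Proof.
rewrite /alpha divfK ?lt0r_neq0 // /count_below -sum1_card natr_sum [RHS]big_mkcond.
by apply: eq_bigr => x _; rewrite inE /f; case: (A x).
Qed.

Let alpha01 : 0 <= alpha <= 1.
Proof.
rewrite /alpha divr_ge0 //= ler_pdivrMr // mul1r ler_nat.
by rewrite (leq_trans (max_card _)) // card_ord.
Qed.

(* Without a genuine pattern, only the x near N can contribute, through
   wrapping around modulo N. *)
Lemma pattern_sum_le (b0 D k M : nat) (b : {ffun 'I_k -> 'I_D}) :
  (b0 <= D.+1)%N -> (3 * D * M <= N)%N -> ~ has_pattern A N b0 b ->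
  \sum_(w : 'I_N * 'I_M) \prod_i f (w.1 + ((b0 + b i) * w.2.+1)%:R)
    <= (2 * D * M * M)%:R.
Proof.
move=> hb0 hM nopat.
pose top := [pred x : 'I_N | N <= x + 2 * D * M]%N.
rewrite -(pair_bigA _ (fun (x : 'I_N) (m : 'I_M) => \prod_i f (x + ((b0 + b i) * m.+1)%:R))) /=.
have hprod (u : 'I_k -> 'I_N) : 0 <= \prod_i f (u i) <= 1.
  by elim/big_ind: _ => [|x y|i _]; rewrite ?ler01 ?lexx // => /andP[? ?] /andP[? ?]; rewrite mulr_ge0 ?mulr_ile1.
apply: (@le_trans _ _ (\sum_(x in top) M%:R)).
  rewrite [leRHS]big_mkcond; apply: ler_sum => x _; case: ifPn => [_|].
    rewrite -[M in leRHS]card_ord -sumr_const; apply: ler_sum => m _.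
    by have /andP[] := hprod (fun i => x + ((b0 + b i) * m.+1)%:R).
  rewrite inE -ltnNge => hx; rewrite big1 // => m _.
  apply/eqP/negPn/negP => /prodf_neq0 nz; apply: nopat; exists (val x), m.+1.
  have mM := ltn_ord m; split=> // [|i].
    by apply: leq_trans hM; rewrite leq_mul2l mM orbT.
  have hbi : ((b0 + b i) * m.+1 <= 2 * D * M)%N by apply: leq_mul => //; have := ltn_ord (b i); lia.
  have lt_N : (x + (b0 + b i) * m.+1 < N)%N by apply: leq_ltn_trans hx; rewrite leq_add2l.
  split => //; have := nz i isT; rewrite /f val_shift modn_small //.
  by case: (A _); rewrite // eqxx.
rewrite sumr_const -mulrnA ler_nat mulnC leq_mul2r card_top orbT //.
Qed.

(** If [f - alpha] has small mean square on all progressions of difference at most 2 kappa,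
    [second_moment] and Chebyshev's inequality bound the bad tuples; otherwise [exists_increment]
    applies. *)
Lemma density_dichotomy (b0 D k K Lam kappa M r l : nat) :
  (0 < K)%N -> (N <= K * count_below A N)%N -> (0 < Lam)%N ->
  kappa = (4 * Lam ^ 2)%N -> (b0 <= D.+1)%N -> (0 < D)%N -> (0 < M)%N ->
  (4 * K ^ k * D * M <= N)%N -> (20 * k * K ^ (2 * k) * K <= Lam)%N ->
  (0 < r)%N -> (kappa.*2 <= D)%N -> (16 * kappa * r <= N)%N ->
  (2 * N * kappa <= r * M)%N -> (128 * kappa ^ 2 * r * l <= N * D)%N -> (0 < l)%N ->
  (kappa.*2 * l * (256 * Lam ^ 4) <= N)%N ->
  (K * bad_count A N b0 D k <= D ^ k)%N \/
  exists x0 q, [/\ (0 < q)%N, (x0 + q * l <= N)%N &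
    alpha + (256 * Lam ^ 4)%:R^-1 <=
      (count_below (fun i => A (x0 + q * i)%N) l)%:R / l%:R].
Proof.
move=> K0 hK L0 kE hb0 D0 M0 hM hL r0 kD kr rM hl l0 hkl.
have lr : 0 < l%:R :> R by rewrite ltr0n.
have Lr : 0 < Lam%:R :> R by rewrite ltr0n.
have Dr : 0 < D%:R :> R by rewrite ltr0n.
have Kr : 0 < K%:R :> R by rewrite ltr0n.
have Mr : 0 < M%:R :> R by rewrite ltr0n.
have krE : kappa%:R = 4 * Lam%:R ^+ 2 :> R by rewrite kE natrM natrX.
have k0 : (0 < kappa)%N by rewrite kE muln_gt0 expn_gt0 L0.
pose g x := f x - alpha.
have g1 x : `|g x| <= 1 by rewrite /g ler_norml; have := f01 x; have := alpha01; lra.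
have g_sum : \sum_x g x = 0 by rewrite sumrB sum_f sumr_const card_ord mulr_natr subrr.
(* With this [s] and [kappa], both terms of 2 / kappa + 8 kappa s equal 1 / (2 Lam^2), so
   [second_moment] applies with e = 1 / Lam. *)
pose s : R := (64 * Lam%:R ^+ 4)^-1.
have sE : s / 4 = (256 * Lam ^ 4)%:R^-1.
  by rewrite /s natrM natrX -invfM; congr (_^-1); ring.
have [flat|] := pselect (forall q, (0 < q <= kappa.*2)%N ->
  \sum_x (\sum_(i < l) g (x + (q * i)%:R)) ^+ 2 <= s * l%:R ^+ 2 * N%:R); last first.
  move=> /existsNP[q /not_implyP[/andP[q0 q2] /negP]]; rewrite -ltNge => hq.
  right; have [x hx hs] : exists2 x : 'I_N, (x + q * l <= N)%N &
      s / 4 * l%:R <= \sum_(i < l) g (x + (q * i)%:R).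
    apply: exists_increment => //; apply: (@le_trans _ _ (kappa.*2 * l)%:R).
      by rewrite ler_nat leq_mul2r q2 orbT.
    by rewrite sE mulrC ler_pdivlMr ?ltr0n ?muln_gt0 ?expn_gt0 ?L0 // -natrM ler_nat.
  exists x, q; split => //.
  rewrite -sE ler_pdivlMr // mulrDl.
  have -> : (count_below (fun i => A (x + q * i)%N) l)%:R = \sum_(i < l) f (x + (q * i)%:R).
    rewrite /count_below -sum1_card natr_sum big_mkcond; apply: eq_bigr => i _.
    rewrite inE /f val_shift modn_small; first by case: (A _).
    by apply: leq_trans hx; rewrite ltn_add2l ltn_pmul2l.
  rewrite -lerBrDl (le_trans hs) // /g sumrB sumr_const card_ord.
  by rewrite mulr_natr.
left.
pose a (w : 'I_N * 'I_M) (b : 'I_D) : R := f (w.1 + ((b0 + b) * w.2.+1)%:R).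
have W_E : #|{: 'I_N * 'I_M}|%:R = N%:R * M%:R :> R by rewrite card_prod !card_ord natrM.
have corr : \sum_b \sum_b' `|\sum_w (a w b - alpha) * (a w b' - alpha)|
    <= Lam%:R^-1 ^+ 2 * D%:R ^+ 2 * #|{: 'I_N * 'I_M}|%:R.
  have := correlation_le b0 k0 r0 kD kr rM hl l0 g1 flat.
  have -> : 2 / kappa%:R + 8 * kappa%:R * s = Lam%:R^-1 ^+ 2.
    by rewrite krE /s; field; rewrite lt0r_neq0.
  rewrite W_E; set X := (leRHS) => hX; apply: le_trans (_ : X <= _); last first.
    by rewrite /X le_eqVlt; apply/orP; left; apply/eqP; ring.
  apply: le_trans hX; rewrite le_eqVlt; apply/orP; left; apply/eqP.
  apply: eq_bigr => b _; apply: eq_bigr => b' _; congr `|_|.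
  by rewrite -(pair_bigA _ (fun (x : 'I_N) (m : 'I_M) => (a (x, m) b - alpha) * (a (x, m) b' - alpha))).
have := @second_moment R _ D k a alpha Lam%:R^-1 D0 (fun w b => f01 _) alpha01 _ corr.
rewrite invr_gt0 => /(_ Lr); rewrite W_E; set W := N%:R * M%:R => hvar.
have W0 : 0 < W by rewrite mulr_gt0.
have KK0 : 0 < K%:R ^+ k :> R by rewrite exprn_gt0.
have alphaK : K%:R^-1 <= alpha.
  by rewrite /alpha ler_pdivlMr // ler_pdivrMl // -natrM ler_nat.
(* For a bad tuple the wrapped solutions amount to at most half of K^(-k) W, while the expected
   count is at least K^(-k) W. *)
have hbad (b : {ffun 'I_k -> 'I_D}) : b \in [pred b : {ffun 'I_k -> 'I_D} | ~~ `[< has_pattern A N b0 b >]] ->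
    (K%:R ^- k * W / 2) ^+ 2 <= (\sum_w \prod_i a w (b i) - alpha ^+ k * W) ^+ 2.
  rewrite inE => /asboolPn nopat.
  have K1 : (0 < K ^ k)%N by rewrite expn_gt0 K0.
  have h3 : (3 * D * M <= N)%N by apply: leq_trans hM; rewrite !leq_mul2r (leq_trans _ (leq_pmulr 4 K1)) ?orbT.
  have := pattern_sum_le hb0 h3 nopat; set F := \sum_w _ => hF.
  have hF2 : F <= K%:R ^- k * W / 2.
    apply: le_trans hF _; rewrite -(ler_pM2l KK0).
    rewrite [leRHS](_ : _ = N%:R * M%:R / 2); last by rewrite /W; field; rewrite lt0r_neq0.
    have : (4 * K ^ k * D * M)%:R <= N%:R :> R by rewrite ler_nat.
    move=> /(ler_wpM2r (ltW Mr)); rewrite !natrM natrX; lra.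
  have : K%:R ^- k * W <= alpha ^+ k * W.
    by rewrite ler_wpM2r ?(ltW W0) // -exprVn lerXn2r // ?nnegrE ?invr_ge0 //; case/andP: alpha01.
  have : 0 <= K%:R ^- k * W / 2 by rewrite divr_ge0 // mulr_ge0 ?invr_ge0 ?exprn_ge0 ?ltW.
  by move=> h4 h5; rewrite -[leRHS]sqrrN opprB lerXn2r ?nnegrE //; lra.
(* Chebyshev's inequality; the 20 below is this 5 times the 4 from squaring the half. *)
have : (bad_count A N b0 D k)%:R * (K%:R ^- k * W / 2) ^+ 2 <= 5 * k%:R / Lam%:R * D%:R ^+ k * W ^+ 2.
  apply: le_trans hvar; rewrite mulr_natl -sumr_const.
  rewrite big_mkcond; apply: ler_sum => b _.
  by case: ifP => [/hbad //|_]; rewrite sqr_ge0.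
set bad := (bad_count _ _ _ _ _)%:R; set X := bad * _; set Y := (leRHS) => h.
have {}h : bad * Lam%:R <= 20 * k%:R * K%:R ^+ k ^+ 2 * D%:R ^+ k.
  have -> : bad * Lam%:R = X * (4 * K%:R ^+ k ^+ 2 * Lam%:R / W ^+ 2).
    by rewrite /X; field; rewrite !lt0r_neq0.
  have -> : 20 * k%:R * K%:R ^+ k ^+ 2 * D%:R ^+ k = Y * (4 * K%:R ^+ k ^+ 2 * Lam%:R / W ^+ 2).
    by rewrite /Y; field; rewrite !lt0r_neq0.
  by rewrite ler_wpM2r // divr_ge0 ?mulr_ge0 ?exprn_ge0 ?ltW // exprn_ge0 ltW.
have hL' : 20 * k%:R * K%:R ^+ k ^+ 2 * K%:R <= Lam%:R :> R.
  by rewrite -exprM mulnC -natrX -!natrM ler_nat.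
rewrite -(ler_nat R) natrM natrX -(ler_pM2r Lr).
apply: (@le_trans _ _ (20 * k%:R * K%:R ^+ k ^+ 2 * K%:R * D%:R ^+ k)).
  by have := ler_wpM2l (ltW Kr) h; rewrite -/bad; lra.
by rewrite [leRHS]mulrC ler_wpM2r // exprn_ge0.
Qed.
End Dichotomy.

(** * Iteration of the density increment *)

Section Iteration.
Variables (R : realType) (k K D b0 : nat).
Hypotheses (K_large : (2 ^ 17 <= K)%N) (kK : (20 * k <= K)%N).
Hypotheses (D_large : (K ^ (4 * k + 5) <= D)%N) (b0D : (b0 <= D.+1)%N).
Let p := (K ^ k)%N.
Let Lam := (p ^ 2 * K ^ 2)%N.
Let kappa := (4 * Lam ^ 2)%N.
(** The exponent comes from the costliest condition, 128 kappa^2 r l <= N D, which asks for N / l >=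
    2^17 p^13 K^12; a thirteenth factor [K] absorbs 2^17. *)
Let e := (13 * k + 13)%N.

Let K0 : (0 < K)%N. Proof. by apply: leq_trans _ K_large; rewrite expn_gt0. Qed.
Let p0 : (0 < p)%N. Proof. by rewrite expn_gt0 K0. Qed.

Let KeE : (K ^ e = p ^ 13 * K ^ 13)%N.
Proof. by rewrite /e expnD (mulnC 13) expnM. Qed.

Let le_Ke (a i j : nat) : (a <= 2 ^ 17)%N -> (i <= 13)%N -> (j <= 12)%N ->
  (a * (p ^ i * K ^ j) <= K ^ e)%N.
Proof.
move=> ha hi hj; rewrite KeE (_ : p ^ 13 * K ^ 13 = K * (p ^ 13 * K ^ 12))%N; last by ring.
apply: leq_mul; first exact: leq_trans ha K_large.
by rewrite leq_mul // leq_pexp2l.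
Qed.

Let D0 : (0 < D)%N.
Proof. by apply: leq_trans _ D_large; rewrite expn_gt0 K0. Qed.

(** Induction on the number of increments that fit below density 1; [t = 0] contradicts density at
    most 1. Each step divides [N] by [K ^ e], up to rounding, and the density stays at least 1 /
    K. *)
Lemma density_iteration (t N : nat) (A : pred nat) :
  (D * K ^ e * K ^ (e * t) <= N)%N -> (N <= K * count_below A N)%N ->
  1 - t%:R / (256 * Lam ^ 4)%:R < (count_below A N)%:R / N%:R :> R ->
  (K * bad_count A N b0 D k <= D ^ k)%N.
Proof.
have L0 : (0 < Lam)%N by rewrite muln_gt0 !expn_gt0 K0.
elim: t N A => [|t IH] N A hN hK.
  rewrite mul0r subr0 => h; exfalso; move: h; apply/negP; rewrite -leNgt.
  have N0 : (0 < N)%N by apply: leq_trans hN; rewrite !muln_gt0 D0 !expn_gt0 K0.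
  rewrite ler_pdivrMr ?ltr0n // mul1r ler_nat.
  by rewrite (leq_trans (max_card _)) // card_ord.
move=> hdens.
have hN1 : (D * K ^ e * K ^ (e * t) * K ^ e <= N)%N by rewrite -mulnA -expnD addnC -mulnS.
have DK : (D * K ^ e <= N)%N.
  by apply: leq_trans hN1; rewrite -mulnA leq_pmulr // muln_gt0 !expn_gt0 K0.
have N2 : (2 <= N)%N.
  by apply: leq_trans DK; apply: leq_trans (@le_Ke 2 0 0 isT isT isT) _; exact: leq_pmull.
have [n NE] : exists n, N = n.+2 by case: (N) N2 => [|[|n]] // _; exists n.
(* [M] is the largest value for which wrapping is harmless. Rounding loses at most a factor 2, so N
   <= 8 p D M, and [r] is chosen to give 2 N kappa <= r M. *)
pose l := (N %/ K ^ e)%N; pose M := (N %/ (4 * p * D))%N.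
pose r := (16 * kappa * p * D)%N.
have hl : (D * K ^ e * K ^ (e * t) <= l)%N by rewrite leq_divRL ?expn_gt0 ?K0.
have l0 : (0 < l)%N by apply: leq_trans hl; rewrite !muln_gt0 D0 !expn_gt0 K0.
have lN : (l * K ^ e <= N)%N by exact: leq_divM.
have pD0 : (0 < 4 * p * D)%N by rewrite !muln_gt0 p0 D0.
have M0 : (0 < M)%N.
  rewrite divn_gt0 // (leq_trans _ DK) // mulnC leq_mul2l; apply/orP; right.
  by have := @le_Ke 4 1 0 isT isT isT; rewrite expn1 expn0 muln1.
have NM : (N < M.+1 * (4 * p * D))%N by rewrite -ltn_divLR.
have k0 : (0 < kappa)%N by rewrite muln_gt0 expn_gt0 L0.
have [hbad|[x0 [q [q0 hq hinc]]]] : (K * bad_count A N b0 D k <= D ^ k)%N \/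
    exists x0 q, [/\ (0 < q)%N, (x0 + q * l <= N)%N &
    (count_below A N)%:R / N%:R + (256 * Lam ^ 4)%:R^-1 <=
      (count_below (fun i => A (x0 + q * i)%N) l)%:R / l%:R :> R].
- rewrite NE; apply: (@density_dichotomy R n A b0 D k K Lam kappa M r l) => //; rewrite -?NE //.
  + by rewrite -/p mulnC leq_divM.
  + rewrite (mulnC 2 k) expnM -/p (_ : 20 * k * p ^ 2 * K = 20 * k * (p ^ 2 * K))%N; last by ring.
    apply: leq_trans (leq_mul kK (leqnn _)) _.
    by rewrite /Lam (_ : K * (p ^ 2 * K) = p ^ 2 * K ^ 2)%N //; ring.
  + by rewrite muln_gt0 D0 muln_gt0 p0 muln_gt0 k0.
  + apply: leq_trans D_large; rewrite expnD (mulnC 4 k) expnM -/p -mul2n.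
    rewrite (_ : 2 * kappa = 8 * (p ^ 4 * K ^ 4))%N; last by rewrite /kappa /Lam; ring.
    rewrite (_ : p ^ 4 * K ^ 5 = K * (p ^ 4 * K ^ 4))%N; last by ring.
    by rewrite leq_mul2r (leq_trans _ K_large) ?orbT.
  + apply: leq_trans DK; rewrite (_ : 16 * kappa * r = D * (4096 * (p ^ 9 * K ^ 8)))%N; last by rewrite /r /kappa /Lam; ring.
    by rewrite leq_mul2l le_Ke ?orbT.
  + have NM2 : (N <= 2 * M * (4 * p * D))%N.
      by apply: leq_trans (ltnW NM) _; apply: leq_mul => //; rewrite mul2n -addnn -[M.+1]addn1 leq_add2l.
    rewrite (_ : 2 * N * kappa = N * (2 * kappa))%N; last by ring.
    apply: leq_trans (leq_mul NM2 (leqnn _)) _; rewrite leq_eqVlt; apply/orP; left; apply/eqP.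
    by rewrite /r; ring.
  + rewrite (_ : 128 * _ * _ * _ = 2 ^ 17 * (p ^ 13 * K ^ 12) * l * D)%N; last by rewrite /r /kappa /Lam; ring.
    rewrite leq_mul2r; apply/orP; right; apply: leq_trans lN; rewrite mulnC leq_mul2l.
    by rewrite (@le_Ke _ 13 12 (leqnn _)) ?orbT.
  + rewrite -mul2n (_ : _ * (256 * _) = 2048 * (p ^ 12 * K ^ 12) * l)%N; last by rewrite /kappa /Lam; ring.
    by apply: leq_trans lN; rewrite mulnC leq_mul2l le_Ke ?orbT.
- exact: hbad.
apply: leq_trans (leq_mul (leqnn K) (bad_count_sub A b0 D k q0 hq)) _.
have N0 : (0 < N)%N by rewrite NE.
apply: IH => //; last first.
  apply: lt_le_trans hinc; rewrite -ltrBlDr; apply: le_lt_trans hdens.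
  by rewrite -natr1; set X := (256 * _)%:R; rewrite le_eqVlt; apply/orP; left; apply/eqP; ring.
have Kr : 0 < K%:R :> R by rewrite ltr0n.
rewrite -(ler_nat R) natrM -ler_pdivrMl // -ler_pdivlMr ?ltr0n //.
apply: le_trans hinc; apply: (@le_trans _ _ ((count_below A N)%:R / N%:R)).
  by rewrite ler_pdivlMr ?ltr0n // ler_pdivrMl // -natrM ler_nat.
by rewrite lerDl invr_ge0.
Qed.

End Iteration.

Lemma density_core (R : realType) (k K D b0 N : nat) (A : pred nat) :
  (2 ^ 17 <= K)%N -> (20 * k <= K)%N -> (K ^ (8 * k + 10) <= D)%N -> (b0 <= D.+1)%N ->
  (D * K ^ (K ^ (8 * k + 10)) <= N)%N -> (N <= K * count_below A N)%N ->
  (K * bad_count A N b0 D k <= D ^ k)%N.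
Proof.
move=> K_large kK hD b0D hN hK.
have K0 : (0 < K)%N by apply: leq_trans K_large; rewrite expn_gt0.
have N0 : (0 < N)%N.
  by apply: leq_trans hN; rewrite muln_gt0 expn_gt0 K0 (leq_trans _ hD) // expn_gt0 K0.
(* [T] is the reciprocal of one increment, so the initial density condition only asks for positive
   density. *)
pose T := (256 * ((K ^ k) ^ 2 * K ^ 2) ^ 4)%N.
apply: (@density_iteration R k K D b0 K_large kK _ b0D T) => //.
- by apply: leq_trans hD; rewrite leq_pexp2l // leq_add // leq_mul2r orbT.
- apply: leq_trans hN; rewrite -mulnA leq_mul2l -expnD -mulnS leq_pexp2l ?orbT //.
  have TE : T = (256 * K ^ (8 * k + 8))%N.
    rewrite /T expnD (mulnC 8) expnM; set p := (K ^ k)%N; ring.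
  have K514 : (514 <= K)%N by apply: leq_trans _ K_large.
  have Z0 : (0 < K ^ (8 * k + 8))%N by rewrite expn_gt0 K0.
  rewrite TE (_ : 8 * k + 10 = (8 * k + 8).+2)%N; last by rewrite !addnS.
  rewrite !expnS; set Z := (K ^ _)%N in Z0 *.
  (* The two further powers of [K] absorb 13 k + 13 <= 2 K and the factor 257 bounding T + 1. *)
  clear -kK K514 Z0; have h1 : (13 * k + 13 <= 2 * K)%N by lia.
  apply: leq_trans (leq_mul h1 (_ : _ <= 257 * Z)%N) _; first by lia.
  rewrite (_ : 2 * K * (257 * Z) = K * (514 * Z))%N; last by ring.
  by rewrite leq_mul2l leq_mul2r K514 !orbT.
rewrite divff ?subrr; first by rewrite divr_gt0 ?ltr0n //; case: count_below hK => //; rewrite muln0 leqNgt N0.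
by rewrite pnatr_eq0 /T -lt0n muln_gt0 !(expn_gt0, muln_gt0) K0.
Qed.

(** * Passage from integers and real bounds to natural numbers *)

Section Transport.
Variables (R : realType) (k N : nat) (B : R) (A : {fset int}).
Hypotheses (B1 : 2 <= B).
(** The integers in (B/2, B] are b1 + 1, ..., b2, indexed by ['I_D] with offset [b1.+1]. *)
Let b1 := Num.truncn (B / 2).
Let b2 := Num.truncn B.
Let D := (b2 - b1)%N.
(** The shift reflects that [N] starts at 1 and ['I_N] at 0. *)
Let A' : pred nat := fun x => Posz x.+1 \in A.

Let B0 : 0 <= B. Proof. by apply: le_trans B1. Qed.

Let b1B : b1%:R <= B / 2 < b1.+1%:R.
Proof. by rewrite /b1 truncn_itv // divr_ge0. Qed.

Let b2B : b2%:R <= B < b2.+1%:R.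
Proof. by rewrite /b2 truncn_itv. Qed.

(** Equivalently b1 <= D, the condition that [density_core] puts on the offset. *)
Lemma dyadic_half_le : (b1.*2 <= b2)%N.
Proof.
by rewrite -ltnS -(ltr_nat R) -muln2 natrM; case/andP: b1B; case/andP: b2B; lra.
Qed.

Lemma dyadic_size_ge : B / 2 - 1 <= D%:R.
Proof.
have := dyadic_half_le; rewrite -addnn => h; rewrite natrB; last by apply: leq_trans h; exact: leq_addr.
by case/andP: b1B => h1 _; case/andP: b2B => _; rewrite -[b2.+1%:R]natr1; lra.
Qed.

Lemma dyadic_size_le : D%:R <= B.
Proof. by case/andP: b2B => h _; apply: le_trans h; rewrite ler_nat leq_subr. Qed.

Lemma dyadic_le_size : B <= (3 * D)%:R.
Proof.
have := dyadic_half_le; rewrite -addnn => h.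
have D0 : (1 <= b2)%N by rewrite -ltnS -(ltr_nat R); case/andP: b2B => _; apply: le_lt_trans; apply: le_trans B1; rewrite ler_nat.
apply: (@le_trans _ _ b2.+1%:R); first by case/andP: b2B => _ /ltW.
by rewrite ler_nat /D; lia.
Qed.

Let mem_dyadic (i : 'I_D) : Posz (b1.+1 + i) \in dyadic B.
Proof.
rewrite in_dyadic -pmulrn.
case/andP: b1B => _ h1; case/andP: b2B => h2 _; have iD : (i < b2 - b1)%N := ltn_ord i.
apply/andP; split; first by apply: lt_le_trans h1 _; rewrite ler_nat leq_addr.
by apply: le_trans h2; rewrite ler_nat; clear -iD; lia.
Qed.

Let emb (i : 'I_D) : dyadic B := [` mem_dyadic i].

Let emb_inj : injective emb.
Proof. by move=> i i' /(congr1 val) /= [] /addnI /val_inj. Qed.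

Let emb_surj (b : dyadic B) : exists i, emb i = b.
Proof.
have := valP b; rewrite in_dyadic; case: b => -[j|j] /= jB.
  rewrite -pmulrn => /andP[h1 h2].
  have j1 : (b1 < j)%N by rewrite -(ltr_nat R); case/andP: b1B => h3 _; apply: le_lt_trans h3 h1.
  have j2 : (j <= b2)%N by rewrite -ltnS -(ltr_nat R); case/andP: b2B => _ h3; apply: le_lt_trans h2 h3.
  have jD : (j - b1.+1 < D)%N by rewrite /D; clear -j1 j2; lia.
  by exists (Ordinal jD); apply/val_inj => /=; congr Posz; rewrite subnKC.
move=> /andP[h1 _]; exfalso.
have : (Negz j)%:~R <= 0 :> R by rewrite NegzE mulrNz -pmulrn oppr_le0.
by rewrite leNgt (le_lt_trans _ h1) // divr_ge0.
Qed.

Lemma count_segment_ge : A `<=` segment (N%:R : R) -> (#|` A| <= count_below A' N)%N.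
Proof.
move=> AN; have -> : count_below A' N = #|` [fset Posz (val x).+1 | x in [pred x : 'I_N | A' x]]|.
  by rewrite card_imfset /= -?cardE // => x y [] /val_inj.
apply/fsubset_leq_card/fsubsetP => z zA.
have := fsubsetP AN z zA; rewrite in_segment; case: z zA => // -[//|j] zA /andP[_].
rewrite -pmulrn ler_nat => jN; apply/imfsetP.
by exists (Ordinal jN).
Qed.

Lemma has_pattern_contains (b : {ffun 'I_k -> 'I_D}) :
  has_pattern A' N b1.+1 b ->
  contains_pattern A (segment (N%:R / B)) (fun i => val (emb (b i))).
Proof.
move=> [x [m [m0 hm hb]]]; exists (Posz x.+1), (Posz m); split=> [|i]; last first.
  have [_] := hb i; rewrite /A' => h.
  by rewrite /= -PoszM -PoszD addSn.
rewrite in_segment -pmulrn ler_pdivlMr ?(lt_le_trans _ B1) //.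
apply/andP; split; first by [].
apply: (@le_trans _ _ (m%:R * (3 * D)%:R)); first by rewrite ler_wpM2l // dyadic_le_size.
by rewrite -natrM ler_nat mulnC.
Qed.

(** Every tuple over [dyadic B] comes from indices, and a pattern for the indices gives one for the
    tuple, so a bad tuple comes from a bad index tuple. *)
Lemma bad_tuples_le :
  (#|[pred b : {ffun 'I_k -> dyadic B} |
       ~~ `[< contains_pattern A (segment (N%:R / B)) (fun i => val (b i)) >]]|
   <= bad_count A' N b1.+1 D k)%N.
Proof.
pose lift (b : {ffun 'I_k -> 'I_D}) : {ffun 'I_k -> dyadic B} := [ffun i => emb (b i)].
rewrite /bad_count -(card_in_imset (f := lift)).
  apply/subset_leq_card/subsetP => b; rewrite inE => hb.
  have [u uE] := fin_all_exists (fun i => emb_surj (b i)).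
  apply/imsetP; exists (finfun u); last by apply/ffunP => i; rewrite !ffunE uE.
  rewrite inE; apply: contra hb => /asboolP /has_pattern_contains h; apply/asboolP.
  by have <- : (fun i => val (emb (finfun u i))) = (fun i => val (b i));
    first by apply: funext => i; rewrite ffunE uE.
move=> b b' _ _ /ffunP h; apply/ffunP => i.
by have := h i; rewrite !ffunE => /emb_inj.
Qed.

Lemma card_dyadic_ge : (D ^ k <= #|{: {ffun 'I_k -> dyadic B}}|)%N.
Proof.
rewrite card_ffun card_ord -[D in leqLHS]card_ord.
have : (#|'I_D| <= #|{: dyadic B}|)%N by exact: leq_card emb_inj.
by move=> h; case: k => // k'; rewrite leq_exp2r.
Qed.
End Transport.

(** * The choice of parameters in terms of log N *)

(** [density_core] is applied with [K] just above (log N)^c. The exponent c is so small that K^(K^E)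
    <= exp((log N)^(1/2)), which is the room left between [D] and [N]. *)
Theorem theorem1p1 (R : realType) (k : nat) (hk : (3 <= k)%N) :
  exists (c c' C : R) (N0 : nat),
    [/\ 0 < c, 0 < c' < 1, 0 < C &
    forall (N : nat) (B : R) (A : {fset int}),
      (N0 <= N)%N ->
      ln N%:R `^ c^-1 <= B <= N%:R * expR (- (ln N%:R `^ c')) ->
      A `<=` segment (N%:R : R) ->
      N%:R / ln N%:R `^ c <= #|` A|%:R ->
      #|[pred b : {ffun 'I_k -> dyadic B} |
          ~~ `[< contains_pattern A (segment (N%:R / B))
                   (fun i => val (b i)) >]]|%:R
        <= C * ln N%:R `^ (- c) * #|{: {ffun 'I_k -> dyadic B}}|%:R].
Proof.
pose E := (8 * k + 10)%N; pose n4 := (4 * E.+1)%N.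
(* [Y] collects the lower bounds that [K] must satisfy; its summand 2 makes y >= 2. *)
pose Y := (2 ^ 17 + 20 * k + 2)%N; pose c : R := n4%:R^-1.
have n40 : 0 < n4%:R :> R by rewrite ltr0n.
have c0 : 0 < c by rewrite invr_gt0.
(* The threshold for [N] ensures log N >= Y^n4, that is, y >= Y below. *)
exists c, 2^-1, 1, (Num.truncn (expR (Y%:R ^+ n4 : R))).+1.
split=> //; first by rewrite invr_gt0 ltr0n invf_lt1 ?ltr1n ?ltr0n.
move=> N B A hN; set L := ln N%:R => /andP[hB1 hB2] AN hA.
have Y2 : 2 <= Y%:R :> R by rewrite ler_nat leq_addl.
have NR : expR (Y%:R ^+ n4 : R) < N%:R.
  have /andP[_ h] := truncn_itv (expR_ge0 (Y%:R ^+ n4 : R)).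
  by apply: lt_le_trans h _; rewrite ler_nat.
have N0 : 0 < N%:R :> R by apply: le_lt_trans NR; exact: expR_ge0.
have LY : Y%:R ^+ n4 <= L.
  by rewrite -[leLHS]expRK ler_ln ?posrE ?expR_gt0 // ltW.
have L0 : 0 <= L by apply: le_trans LY; rewrite exprn_ge0.
set y := L `^ c.
have y0 : 0 <= y by exact: powR_ge0.
have LE : L = y ^+ n4.
  by rewrite -powR_mulrn // /y -powRrM mulVf ?lt0r_neq0 // powRr1.
have yY : Y%:R <= y.
  rewrite leNgt; apply/negP => lt_yY; move: LY; rewrite leNgt => /negP; apply.
  by rewrite LE ltrXn2r.
have y2 : 2 <= y by exact: le_trans yY.
have yg0 : 0 < y by lra.
(* This fixes n4 = 4 (E + 1): [K] is bounded by y^2, and K^(E + 1) must not exceed (log N)^(1/2). *)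
have sqrtE : L `^ 2^-1 = (y ^+ 2) ^+ E.+1.
  rewrite -exprM -powR_mulrn // /y -powRrM; congr (_ `^ _).
  have e0 : E.+1%:R != 0 :> R by rewrite pnatr_eq0.
  by rewrite /c /n4 !natrM; move: (E.+1%:R : R) e0 => e e0; field.
(* [K] strictly exceeds [y], so 1 / K is below the density of [A]; and K <= y + 1 <= y^2. *)
pose K := (Num.truncn y).+1.
have /andP[truncK yK] := truncn_itv y0.
have Ky : K%:R <= y ^+ 2 by rewrite -natr1; nra.
have YK : (Y <= K)%N by rewrite -(ler_nat R) (le_trans yY) // ltW.
have K0 : 0 < K%:R :> R by rewrite ltr0n.
have y2L : y ^+ 2 <= L by rewrite LE; apply: ler_weXn2l; [lra | rewrite /n4 mulnS].
have L4 : 4 <= L by apply: le_trans y2L; nra.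
have LE1 : 1 <= L ^+ E by rewrite exprn_ege1 //; lra.
have B4 : 4 * L ^+ E <= B.
  apply: le_trans hB1; rewrite invrK powR_mulrn //.
  apply: (@le_trans _ _ (L ^+ E.+1)); first by rewrite exprS ler_wpM2r // (le_trans _ LE1).
  by apply: ler_weXn2l; [lra | exact: leq_pmull].
have B2 : 2 <= B by lra.
pose D := (Num.truncn B - Num.truncn (B / 2))%N.
have KE : K%:R ^+ E <= L ^+ E.
  by rewrite lerXn2r ?nnegrE ?ler0n // (le_trans Ky).
have hD : (K ^ E <= D)%N.
  rewrite -(ler_nat R) natrX (le_trans KE) // (le_trans _ (dyadic_size_ge B2)) //; lra.
have half := dyadic_half_le B2.
(* From K <= exp K, the power is at most exp(K^(E + 1)). *)
have KKE : K%:R ^+ (K ^ E) <= expR (L `^ 2^-1).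
  apply: (@le_trans _ _ (expR K%:R ^+ (K ^ E))).
    by rewrite lerXn2r ?nnegrE ?expR_ge0 //; have := expR_ge1Dx (K%:R : R); lra.
  rewrite -expRM_natl ler_expR sqrtE -natrM -expnSr natrX.
  by rewrite lerXn2r ?nnegrE ?exprn_ge0.
have hN2 : (D * K ^ (K ^ E) <= N)%N.
  rewrite -(ler_nat R) natrM natrX.
  apply: (@le_trans _ _ (N%:R * expR (- (L `^ 2^-1)) * expR (L `^ 2^-1))).
    apply: ler_pM => //; first by rewrite exprn_ge0.
    exact: le_trans (dyadic_size_le B2) hB2.
  by rewrite -mulrA -expRD addNr expR0 mulr1.
have hK : (N <= K * count_below (fun x => Posz x.+1 \in A) N)%N.
  rewrite -(ler_nat R) natrM.
  move: hA; rewrite ler_pdivrMr // => /le_trans; apply.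
  by rewrite mulrC ler_pM // ?ler_nat ?(count_segment_ge AN) // ltW.
have K17 : (2 ^ 17 <= K)%N by apply: leq_trans YK; rewrite /Y -addnA leq_addr.
have K20 : (20 * k <= K)%N by apply: leq_trans YK; rewrite /Y addnAC leq_addl.
have hb : ((Num.truncn (B / 2)).+1 <= D.+1)%N by rewrite ltnS leq_subRL ?addnn // (leq_trans _ half) // -addnn leq_addr.
have core := @density_core R k K D _ N _ K17 K20 hD hb hN2 hK.
have := bad_tuples_le k N A B2; set bad := #|_| => hbad.
rewrite mul1r powRN -/y mulrC ler_pdivlMr //.
apply: (@le_trans _ _ (D ^ k)%:R); last by rewrite ler_nat (card_dyadic_ge k B2).
apply: (@le_trans _ _ (K * bad)%:R).
  by rewrite mulrC natrM ler_wpM2r // ltW.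
by rewrite ler_nat (leq_trans _ core) // leq_mul2l hbad orbT.
Qed.
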